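(* Let $D\subset\mathbb{C}$ be a domain and let $f:D\to\mathbb{C}$ be continuous. Suppose that, for every $a\in D$, $$J_f(a,r)=\int_{C(a,r)}f(\zeta)\,d\zeta=o(r^2)\qquad (r\to0^+,\ 0<r<\rho_D(a)).$$ Then $f$ is holomorphic in $D$.
   Context: A domain is a connected open subset of $\mathbb{C}$. For $a\in\mathbb{C}$ and $r>0$, $C(a,r)=\{z\in\mathbb{C}:|z-a|=r\}$ is the positively oriented circle, so that $J_f(a,r)=\int_{C(a,r)}f(\zeta)\,d\zeta=\int_0^{2\pi}f(a+re^{it})\,ire^{it}\,dt$. For $a\in D$, $\rho_D(a)=\operatorname{dist}(a,\partial D)$, with the convention $\rho_D(a)=\infty$ when $D=\mathbb{C}$. The little-oh condition is pointwise in the center $a$: for each fixed $a\in D$, $J_f(a,r)/r^2\to0$ as $r\to0^+$ (no uniformity in $a$ is assumed). *)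

(* Defs.v *)
From Stdlib Require Import Reals.
From Coquelicot Require Import Coquelicot.

Open Scope R_scope.

Definition connected {T : UniformSpace} (D : T -> Prop) : Prop :=
  forall U V : T -> Prop,
    open U -> open V ->
    (forall z, D z -> U z \/ V z) ->
    (exists z, D z /\ U z) -> (exists z, D z /\ V z) ->
    exists z, D z /\ U z /\ V z.

Definition is_domain (D : C -> Prop) : Prop := open D /\ connected D.

Definition boundary {T : UniformSpace} (D : T -> Prop) (z : T) : Prop :=
  forall U : T -> Prop, locally z U ->
    (exists w, U w /\ D w) /\ (exists w, U w /\ ~ D w).

(* [Glb_Rbar] of the empty set is [p_infty], so [rho D a = p_infty] when [D]
   has no boundary, in particular when [D] is the whole plane. *)
Definition rho (D : C -> Prop) (a : C) : Rbar :=
  Glb_Rbar (fun d => exists z : C, boundary D z /\ d = Cmod (z - a)%C).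

Definition cis (t : R) : C := (cos t, sin t).

(* [RInt] is total: the value is meaningful only when the integrand is
   integrable, which holds for [f] continuous on a domain [D] containing [a]
   and [0 < r < rho D a], since the circle is then contained in [D]. *)
Definition circle_integral (f : C -> C) (a : C) (r : R) : C :=
  RInt (V := C_R_CompleteNormedModule)
    (fun t => (f (a + r * cis t) * (Ci * r * cis t))%C) 0 (2 * PI).

(* Functions on [D] are represented by total functions [C -> C]; as [D] is
   open, complex differentiability at points of [D] depends only on the
   values of [f] on [D]. *)
Definition holomorphic_on (D : C -> Prop) (f : C -> C) : Prop :=
  forall z : C, D z -> ex_derive (K := C_AbsRing) (V := C_NormedModule) f z.

(* Main.v *)
(* After rescaling, [f] is continuous on the closed unit disc. Approximate it uniformly by
   polynomials [f_n] in [z] and its conjugate, and let [w_n] be the polynomial that vanishes on the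
   unit circle with [d w_n / dz = f_n - g_n], where [g_n] is a holomorphic polynomial. By Green's
   formula the circle means of [w_n] have radial derivative [2 * mean (f_n * cis)], so that they
   differ from the value at the center by at most [2 r sup |f_n|]. For circles whose radius is half
   the distance to the boundary this is beaten by the strict concavity of [sqrt (1 - |z|^2)], and the
   maximum principle yields [|w_n| <= C sup |f_n|]. Hence [w_n] converges uniformly; the hypothesis
   [J_f (a, r) = o(r^2)] says that the means of the limit differ from its values by [o(r^2)], and the
   Blaschke-Privalov form of the maximum principle shows that the limit is [0]. Recovering [f_n - g_n]
   from means of [w_n] over circles of a fixed small radius, one sees that [g_n] converges to [f]
   locally uniformly, and Cauchy estimates for [g_n] make [f] differentiable. *)

Require Import Defs.
From Stdlib Require Import Reals Arith Lra Psatz Lia Classical ClassicalEpsilon.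
From Coquelicot Require Import Coquelicot.

Open Scope R_scope.

(** The obstacle is that [f] is merely continuous and the little-oh is not uniform in the center, so
    the circle integrals cannot be summed or compared over a region. A maximum principle needs its
    condition only at the one point where a maximum sits, hence no uniformity; but it speaks of
    means of a function, not of circle integrals. The potential [w] translates between the two: the
    radial derivative of its means is a circle integral of [f]. For continuous [f] such a [w] is
    reached only as a limit, so it must be controlled by the sup norm of the data alone. A sup bound
    gives an error of order [r] in the means, while a smooth strictly concave function loses only
    order [r * r] on small circles. This forces circles of radius comparable to the distance to the
    boundary, and a barrier whose slope blows up there. Means are taken of real parts only;
    imaginary parts come from the same statements for [- Ci * f]. *)

(** * Continuity of functions on the plane *)

Definition cont (G : C -> R) : Prop := forall z : C, continuous G z.

(** Continuity is asked on the whole plane: a function given on the closed disc is first extended by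
    [disc_proj], so that no relative topology is needed. It is tested on components because only
    real functions are averaged. *)
Definition contC (p : C -> C) : Prop :=
  cont (fun z => Re (p z)) /\ cont (fun z => Im (p z)).

Lemma cont_const (c : R) : cont (fun _ => c).
Proof. intros z; apply continuous_const. Qed.

Lemma cont_Re : cont Re.
Proof. intros z; apply (continuous_fst (U := R_UniformSpace) (V := R_UniformSpace)). Qed.

Lemma cont_Im : cont Im.
Proof. intros z; apply (continuous_snd (U := R_UniformSpace) (V := R_UniformSpace)). Qed.

Lemma cont_plus (G H : C -> R) : cont G -> cont H -> cont (fun z => G z + H z).
Proof. intros hG hH z; apply (continuous_plus (V := R_NormedModule)); auto. Qed.

Lemma cont_mult (G H : C -> R) : cont G -> cont H -> cont (fun z => G z * H z).
Proof. intros hG hH z; apply (continuous_mult (K := R_AbsRing)); auto. Qed.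

Lemma cont_minus (G H : C -> R) : cont G -> cont H -> cont (fun z => G z - H z).
Proof. intros hG hH z; apply (continuous_minus (V := R_NormedModule)); auto. Qed.

Lemma cont_comp (h : R -> R) (G : C -> R) :
  (forall x, continuous h x) -> cont G -> cont (fun z => h (G z)).
Proof. intros hh hG z; apply continuous_comp; auto. Qed.

Lemma cont_compC (G : C -> R) (p : C -> C) : cont G -> contC p -> cont (fun z => G (p z)).
Proof.
intros hG [h1 h2] z.
apply (continuous_ext (fun z => G (Re (p z), Im (p z)))).
{ intros w; now destruct (p w). }
apply (continuous_comp_2 (fun z => Re (p z)) (fun z => Im (p z)) (fun x y => G (x, y))); auto.
apply (continuous_ext G); [now intros [x y]|apply hG].
Qed.

Lemma contC_comp (p q : C -> C) : contC p -> contC q -> contC (fun z => p (q z)).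
Proof.
intros [h1 h2] hq; split.
- now apply (cont_compC (fun z => Re (p z))).
- now apply (cont_compC (fun z => Im (p z))).
Qed.

Lemma contC_const (c : C) : contC (fun _ => c).
Proof. split; apply cont_const. Qed.

Lemma contC_id : contC (fun z => z).
Proof. split; [apply cont_Re|apply cont_Im]. Qed.

Lemma cont_ext (G H : C -> R) : (forall z, G z = H z) -> cont G -> cont H.
Proof. intros e hG z; now apply (continuous_ext G). Qed.

Lemma contC_conj : contC Cconj.
Proof.
split; [apply cont_Re|].
apply (cont_ext (fun z => 0 - Im z)); [intros z; rewrite im_conj; ring|].
apply cont_minus; [apply cont_const|apply cont_Im].
Qed.

Lemma Re_plus (z w : C) : Re (z + w)%C = Re z + Re w.
Proof. reflexivity. Qed.
Lemma Im_plus (z w : C) : Im (z + w)%C = Im z + Im w.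
Proof. reflexivity. Qed.
Lemma Re_mult (z w : C) : Re (z * w)%C = Re z * Re w - Im z * Im w.
Proof. reflexivity. Qed.
Lemma Im_mult (z w : C) : Im (z * w)%C = Re z * Im w + Im z * Re w.
Proof. reflexivity. Qed.

Lemma contC_plus (p q : C -> C) : contC p -> contC q -> contC (fun z => p z + q z)%C.
Proof. intros [a b] [c d]; split; now apply cont_plus. Qed.

Lemma contC_mult (p q : C -> C) : contC p -> contC q -> contC (fun z => p z * q z)%C.
Proof.
intros [a b] [c d]; split.
- apply cont_minus; now apply cont_mult.
- apply cont_plus; now apply cont_mult.
Qed.

Lemma contC_ext (p q : C -> C) : (forall z, p z = q z) -> contC p -> contC q.
Proof.
intros e [a b]; split; [apply (cont_ext _ _ (fun z => f_equal Re (e z)) a)|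
  apply (cont_ext _ _ (fun z => f_equal Im (e z)) b)].
Qed.

Lemma circle_pt (a : C) (r t : R) :
  (a + r * cis t)%C = (Re a + r * cos t, Im a + r * sin t).
Proof. unfold cis, Cplus, Cmult, RtoC, Re, Im; simpl; f_equal; ring. Qed.

(** Joint continuity in radius and angle is what differentiation under the integral sign asks
    for. *)
Lemma cont_polar (G : C -> R) (a : C) (r t : R) :
  cont G -> continuity_2d_pt (fun r t => G (a + r * cis t)%C) r t.
Proof.
intros hG; apply continuity_2d_pt_filterlim.
change (continuous (fun z : R * R => G (a + fst z * cis (snd z))%C) (r, t)).
apply (continuous_ext
  (fun z : R * R => G (Re a + fst z * cos (snd z), Im a + fst z * sin (snd z)))).
{ intros z; now rewrite circle_pt. }
apply (continuous_comp_2 (fun z : R * R => Re a + fst z * cos (snd z))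
  (fun z : R * R => Im a + fst z * sin (snd z)) (fun x y => G (x, y))).
- apply (continuous_plus (V := R_NormedModule)); [apply continuous_const|].
  apply (continuous_mult (K := R_AbsRing)); [apply continuous_fst|].
  apply continuous_comp; [apply continuous_snd|apply continuous_cos].
- apply (continuous_plus (V := R_NormedModule)); [apply continuous_const|].
  apply (continuous_mult (K := R_AbsRing)); [apply continuous_fst|].
  apply continuous_comp; [apply continuous_snd|apply continuous_sin].
- apply (continuous_ext G); [now intros [x y]|apply hG].
Qed.

Lemma cont_circle (G : C -> R) (a : C) (r t : R) :
  cont G -> continuous (fun t => G (a + r * cis t)%C) t.
Proof.
intros hG.
apply (continuous_ext (fun t => G (Re a + r * cos t, Im a + r * sin t))).
{ intros s; now rewrite circle_pt. }
apply (continuous_comp_2 (fun t => Re a + r * cos t)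
  (fun t => Im a + r * sin t) (fun x y => G (x, y))).
- apply (ex_derive_continuous (V := R_NormedModule)); auto_derive; auto.
- apply (ex_derive_continuous (V := R_NormedModule)); auto_derive; auto.
- apply (continuous_ext G); [now intros [x y]|apply hG].
Qed.

(** * Means over circles *)

Definition avg (phi : R -> R) : R := RInt phi 0 (2 * PI) / (2 * PI).

Lemma two_PI_pos : 0 < 2 * PI.
Proof. generalize PI_RGT_0; lra. Qed.

Definition continuous1 (phi : R -> R) : Prop := forall t, continuous phi t.

Lemma continuous1_ex (phi : R -> R) (a b : R) : continuous1 phi -> ex_RInt phi a b.
Proof. intros h; apply (ex_RInt_continuous (V := R_CompleteNormedModule)); auto. Qed.

Lemma avg_ext (phi psi : R -> R) : (forall t, phi t = psi t) -> avg phi = avg psi.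
Proof. intros h; unfold avg; f_equal; apply RInt_ext; auto. Qed.

Lemma avg_plus (phi psi : R -> R) : continuous1 phi -> continuous1 psi ->
  avg (fun t => phi t + psi t) = avg phi + avg psi.
Proof.
intros h1 h2; unfold avg.
rewrite (RInt_plus (V := R_CompleteNormedModule)) by now apply continuous1_ex.
unfold plus; simpl; field; apply PI_neq0.
Qed.

Lemma avg_scal (c : R) (phi : R -> R) : continuous1 phi ->
  avg (fun t => c * phi t) = c * avg phi.
Proof.
intros h; unfold avg.
rewrite (RInt_scal (V := R_CompleteNormedModule)) by now apply continuous1_ex.
unfold scal; simpl; unfold mult; simpl; field; apply PI_neq0.
Qed.

Lemma avg_const (c : R) : avg (fun _ => c) = c.
Proof.
unfold avg; rewrite RInt_const; unfold scal; simpl; unfold mult; simpl.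
field; apply PI_neq0.
Qed.

Lemma avg_le (phi psi : R -> R) : continuous1 phi -> continuous1 psi ->
  (forall t, phi t <= psi t) -> avg phi <= avg psi.
Proof.
intros h1 h2 h; unfold avg, Rdiv; apply Rmult_le_compat_r.
- left; apply Rinv_0_lt_compat, two_PI_pos.
- apply RInt_le; auto using continuous1_ex; generalize two_PI_pos; lra.
Qed.

Lemma avg_abs (phi : R -> R) (K : R) : continuous1 phi ->
  (forall t, Rabs (phi t) <= K) -> Rabs (avg phi) <= K.
Proof.
intros h1 h.
assert (hc : forall c, continuous1 (fun _ => c)) by (intros c t; apply continuous_const).
apply Rabs_le; split.
- rewrite <- (avg_const (- K)); apply avg_le; auto.
  intros t; generalize (h t); intros; apply Rabs_le_between in H; lra.
- rewrite <- (avg_const K) at 1; apply avg_le; auto.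
  intros t; generalize (h t); intros; apply Rabs_le_between in H; lra.
Qed.

Lemma avg_minus (phi psi : R -> R) : continuous1 phi -> continuous1 psi ->
  avg (fun t => phi t - psi t) = avg phi - avg psi.
Proof.
intros h1 h2.
rewrite (avg_ext _ (fun t => phi t + (-1) * psi t)) by (intros; ring).
rewrite avg_plus, avg_scal; auto; [ring|].
intros t; apply (continuous_mult (K := R_AbsRing)); auto; apply continuous_const.
Qed.

Lemma avg_derivative (G dG : R -> R -> R) (r : R) :
  (forall r t, is_derive (fun r => G r t) r (dG r t)) ->
  (forall r t, continuity_2d_pt dG r t) ->
  (forall r, continuous1 (G r)) ->
  is_derive (fun r => avg (G r)) r (avg (dG r)).
Proof.
intros hd hc hG.
assert (e : forall r t, Derive (fun r => G r t) r = dG r t)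
  by (intros; now apply is_derive_unique).
apply (is_derive_ext (fun r => / (2 * PI) * RInt (G r) 0 (2 * PI))).
{ intros s; apply Rmult_comm. }
replace (avg (dG r)) with (/ (2 * PI) * RInt (fun t => Derive (fun r => G r t) r) 0 (2 * PI)).
2:{ unfold avg, Rdiv; rewrite Rmult_comm; apply Rmult_eq_compat_r, RInt_ext; intros; apply e. }
apply is_derive_scal, is_derive_RInt_param.
- exists (mkposreal 1 Rlt_0_1); intros s _ t _; eexists; apply hd.
- intros t _; apply (continuity_2d_pt_ext dG); [intros; now rewrite e|apply hc].
- exists (mkposreal 1 Rlt_0_1); intros s _; now apply continuous1_ex.
Qed.

Lemma avg_period (phi dphi : R -> R) :
  (forall t, is_derive phi t (dphi t)) -> continuous1 dphi ->
  phi (2 * PI) = phi 0 -> avg dphi = 0.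
Proof.
intros hd hc e; unfold avg.
assert (h : is_RInt dphi 0 (2 * PI) (minus (phi (2 * PI)) (phi 0)))
  by (apply (is_RInt_derive (V := R_CompleteNormedModule)); auto).
rewrite (is_RInt_unique _ _ _ _ h), e; rewrite minus_eq_zero.
unfold zero; simpl; unfold Rdiv; ring.
Qed.
(** * Wirtinger derivatives *)

(** Differentiability is used only along radii, circles and segments. Defining Wirtinger derivatives
    by the chain rule along all differentiable curves serves these three uses directly, and sums and
    products are immediate. *)
Definition is_derive_curve (g : R -> C) (t : R) (v : C) : Prop :=
  is_derive (fun s => Re (g s)) t (Re v) /\ is_derive (fun s => Im (g s)) t (Im v).

(* [p1] and [p2] are the derivatives of [p] with respect to [z] and its conjugate. *)
Definition is_wirtinger (p p1 p2 : C -> C) : Prop :=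
  contC p1 /\ contC p2 /\ contC p /\
  forall g t v, is_derive_curve g t v ->
    is_derive_curve (fun s => p (g s)) t (p1 (g t) * v + p2 (g t) * Cconj v)%C.

Definition zeroC (z : C) : C := RtoC 0.

Lemma is_wirtinger_const (c : C) : is_wirtinger (fun _ => c) zeroC zeroC.
Proof.
repeat (split; [apply contC_const|]).
intros g t v _; unfold zeroC.
replace (0 * v + 0 * Cconj v)%C with (RtoC 0) by ring.
split; apply (is_derive_const (V := R_NormedModule)).
Qed.

Lemma is_wirtinger_ext (p q p1 q1 p2 q2 : C -> C) :
  (forall z, p z = q z) -> (forall z, p1 z = q1 z) -> (forall z, p2 z = q2 z) ->
  is_wirtinger p p1 p2 -> is_wirtinger q q1 q2.
Proof.
intros e e1 e2 (c1 & c2 & c & h).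
split; [now apply (contC_ext p1)|split; [now apply (contC_ext p2)|]].
split; [now apply (contC_ext p)|].
intros g t v hv; split.
- apply (is_derive_ext (fun s => Re (p (g s)))); [intros; now rewrite e|].
  rewrite <- e1, <- e2; now apply h.
- apply (is_derive_ext (fun s => Im (p (g s)))); [intros; now rewrite e|].
  rewrite <- e1, <- e2; now apply h.
Qed.

Lemma is_wirtinger_id : is_wirtinger (fun z => z) (fun _ => RtoC 1) zeroC.
Proof.
split; [apply contC_const|split; [apply contC_const|split; [apply contC_id|]]].
intros g t v h; unfold zeroC; now replace (1 * v + 0 * Cconj v)%C with v by ring.
Qed.

Lemma is_wirtinger_conj : is_wirtinger Cconj zeroC (fun _ => RtoC 1).
Proof.
split; [apply contC_const|split; [apply contC_const|split; [apply contC_conj|]]].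
intros g t v [h1 h2]; unfold zeroC; replace (0 * v + 1 * Cconj v)%C with (Cconj v) by ring.
split; [exact h1|].
apply (is_derive_opp (V := R_NormedModule)); exact h2.
Qed.

Lemma is_wirtinger_plus (p p1 p2 q q1 q2 : C -> C) :
  is_wirtinger p p1 p2 -> is_wirtinger q q1 q2 ->
  is_wirtinger (fun z => p z + q z)%C (fun z => p1 z + q1 z)%C (fun z => p2 z + q2 z)%C.
Proof.
intros (c1 & c2 & c & h) (d1 & d2 & d & k).
split; [now apply contC_plus|split; [now apply contC_plus|split; [now apply contC_plus|]]].
intros g t v hv; destruct (h g t v hv) as [h1 h2], (k g t v hv) as [k1 k2].
replace ((p1 (g t) + q1 (g t)) * v + (p2 (g t) + q2 (g t)) * Cconj v)%C with
  ((p1 (g t) * v + p2 (g t) * Cconj v) + (q1 (g t) * v + q2 (g t) * Cconj v))%C by ring.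
split; apply (is_derive_plus (V := R_NormedModule)); assumption.
Qed.

Lemma is_derive_Rmult (f g : R -> R) (x df dg : R) :
  is_derive f x df -> is_derive g x dg ->
  is_derive (fun s => f s * g s) x (df * g x + f x * dg).
Proof. intros h1 h2; apply (is_derive_mult f g x df dg h1 h2); intros; apply Rmult_comm. Qed.

Lemma is_wirtinger_mult (p p1 p2 q q1 q2 : C -> C) :
  is_wirtinger p p1 p2 -> is_wirtinger q q1 q2 ->
  is_wirtinger (fun z => p z * q z)%C (fun z => p1 z * q z + p z * q1 z)%C
    (fun z => p2 z * q z + p z * q2 z)%C.
Proof.
intros (c1 & c2 & c & h) (d1 & d2 & d & k).
split; [|split; [|split]]; auto using contC_plus, contC_mult.
intros g t v hv; destruct (h g t v hv) as [h1 h2], (k g t v hv) as [k1 k2].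
set (dp := (p1 (g t) * v + p2 (g t) * Cconj v)%C) in *.
set (dq := (q1 (g t) * v + q2 (g t) * Cconj v)%C) in *.
replace (_ + _)%C with (dp * q (g t) + p (g t) * dq)%C by (unfold dp, dq; ring).
split.
- apply (is_derive_ext
    (fun s => Re (p (g s)) * Re (q (g s)) - Im (p (g s)) * Im (q (g s)))); [reflexivity|].
  replace (Re _) with
   ((Re dp * Re (q (g t)) + Re (p (g t)) * Re dq) - (Im dp * Im (q (g t)) + Im (p (g t)) * Im dq))
   by (rewrite Re_plus, !Re_mult; ring).
  apply (is_derive_minus (V := R_NormedModule)); now apply is_derive_Rmult.
- apply (is_derive_ext
    (fun s => Re (p (g s)) * Im (q (g s)) + Im (p (g s)) * Re (q (g s)))); [reflexivity|].
  replace (Im _) with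
   ((Re dp * Im (q (g t)) + Re (p (g t)) * Im dq) + (Im dp * Re (q (g t)) + Im (p (g t)) * Re dq))
   by (rewrite Im_plus, !Im_mult; ring).
  apply (is_derive_plus (V := R_NormedModule)); now apply is_derive_Rmult.
Qed.

Lemma is_wirtinger_scal (c : C) (p p1 p2 : C -> C) :
  is_wirtinger p p1 p2 ->
  is_wirtinger (fun z => c * p z)%C (fun z => c * p1 z)%C (fun z => c * p2 z)%C.
Proof.
intros h; generalize (is_wirtinger_mult _ _ _ _ _ _ (is_wirtinger_const c) h).
apply is_wirtinger_ext; intros; unfold zeroC; ring.
Qed.

(** * Derivatives of circle means *)

Lemma Re_Ci (z : C) : Re (Ci * z)%C = - Im z.
Proof. unfold Ci, Re, Im; simpl; ring. Qed.
Lemma Im_Ci (z : C) : Im (Ci * z)%C = Re z.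
Proof. unfold Ci, Re, Im; simpl; ring. Qed.

Lemma contC_circle (p : C -> C) (a : C) (r : R) : contC p ->
  continuous1 (fun t => Re (p (a + r * cis t)%C)).
Proof. intros [h _] t; now apply (cont_circle (fun z => Re (p z))). Qed.

Lemma is_derive_curve_radius (a : C) (r t : R) :
  is_derive_curve (fun r : R => a + r * cis t)%C r (cis t).
Proof.
split.
- apply (is_derive_ext (fun r => Re a + r * cos t)); [intros; now rewrite circle_pt|].
  simpl; auto_derive; auto; ring.
- apply (is_derive_ext (fun r => Im a + r * sin t)); [intros; now rewrite circle_pt|].
  simpl; auto_derive; auto; ring.
Qed.

Lemma is_derive_curve_angle (a : C) (r t : R) :
  is_derive_curve (fun t => a + r * cis t)%C t (Ci * (r * cis t))%C.
Proof.
split.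
- apply (is_derive_ext (fun t => Re a + r * cos t)); [intros; now rewrite circle_pt|].
  rewrite Re_Ci; simpl; auto_derive; auto; ring.
- apply (is_derive_ext (fun t => Im a + r * sin t)); [intros; now rewrite circle_pt|].
  rewrite Im_Ci; simpl; auto_derive; auto; ring.
Qed.

Lemma continuity_2d_cos (r t : R) : continuity_2d_pt (fun _ t => cos t) r t.
Proof.
apply continuity_1d_2d_pt_comp; [|apply continuity_2d_pt_id2].
apply continuity_cos.
Qed.

Lemma continuity_2d_sin (r t : R) : continuity_2d_pt (fun _ t => sin t) r t.
Proof.
apply continuity_1d_2d_pt_comp; [|apply continuity_2d_pt_id2].
apply continuity_sin.
Qed.

Lemma avg_circle_Re_cis (p : C -> C) (a : C) (r : R) : contC p ->
  continuous1 (fun t => Re (p (a + r * cis t) * cis t)%C).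
Proof.
intros [h1 h2] t.
apply (continuous_minus (V := R_NormedModule)); apply (continuous_mult (K := R_AbsRing)).
- now apply (cont_circle (fun z => Re (p z))).
- apply continuous_cos.
- now apply (cont_circle (fun z => Im (p z))).
- apply continuous_sin.
Qed.

Lemma avg_circle_Re_conj_cis (p : C -> C) (a : C) (r : R) : contC p ->
  continuous1 (fun t => Re (p (a + r * cis t) * Cconj (cis t))%C).
Proof.
intros [h1 h2] t.
apply (continuous_minus (V := R_NormedModule)); apply (continuous_mult (K := R_AbsRing)).
- now apply (cont_circle (fun z => Re (p z))).
- apply continuous_cos.
- now apply (cont_circle (fun z => Im (p z))).
- apply (continuous_opp (V := R_NormedModule)), continuous_sin.
Qed.

(** Unlike [is_derive_avg], this form with both Wirtinger terms holds at [r = 0] too, which gives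
    continuity of the means up to the center. *)
Lemma avg_derivative_raw (p p1 p2 : C -> C) (a : C) (r : R) :
  is_wirtinger p p1 p2 ->
  is_derive (fun r : R => avg (fun t => Re (p (a + r * cis t)%C))) r
    (avg (fun t => Re (p1 (a + r * cis t) * cis t)%C + Re (p2 (a + r * cis t) * Cconj (cis t))%C)).
Proof.
intros (c1 & c2 & c & h).
apply (avg_derivative (fun r t => Re (p (a + r * cis t)%C))
  (fun r t => Re (p1 (a + r * cis t) * cis t)%C + Re (p2 (a + r * cis t) * Cconj (cis t))%C)).
- intros s t; exact (proj1 (h _ _ _ (is_derive_curve_radius a s t))).
- destruct c1 as [c1 c1'], c2 as [c2 c2'].
  intros s t.
  apply (continuity_2d_pt_ext (fun s t =>
     (Re (p1 (a + s * cis t)%C) * cos t - Im (p1 (a + s * cis t)%C) * sin t) +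
     (Re (p2 (a + s * cis t)%C) * cos t + Im (p2 (a + s * cis t)%C) * sin t))).
  { intros; rewrite !Re_mult, re_conj, im_conj; unfold cis; simpl; ring. }
  apply continuity_2d_pt_plus;
    [apply continuity_2d_pt_minus|apply continuity_2d_pt_plus];
    apply continuity_2d_pt_mult; try apply continuity_2d_cos; try apply continuity_2d_sin.
  + now apply (cont_polar (fun z => Re (p1 z))).
  + now apply (cont_polar (fun z => Im (p1 z))).
  + now apply (cont_polar (fun z => Re (p2 z))).
  + now apply (cont_polar (fun z => Im (p2 z))).
- intros s; now apply contC_circle.
Qed.

(* The integrand of the difference is the angular derivative of [Im p], up to the factor [r]. *)
Lemma avg_wirtinger_eq (p p1 p2 : C -> C) (a : C) (r : R) :
  is_wirtinger p p1 p2 -> r <> 0 ->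
  avg (fun t => Re (p1 (a + r * cis t) * cis t)%C) =
  avg (fun t => Re (p2 (a + r * cis t) * Cconj (cis t))%C).
Proof.
intros (c1 & c2 & c & h) hr.
apply Rminus_diag_uniq.
assert (k1 := avg_circle_Re_cis p1 a r c1).
assert (k2 := avg_circle_Re_conj_cis p2 a r c2).
rewrite <- avg_minus by assumption.
apply (Rmult_eq_reg_l r); auto; rewrite Rmult_0_r, <- avg_scal.
2:{ intros t; apply (continuous_minus (V := R_NormedModule)); auto. }
apply (avg_period (fun t => Im (p (a + r * cis t)%C))).
- intros t.
  replace (_ * _) with (Im (p1 (a + r * cis t) * (Ci * (r * cis t)) +
     p2 (a + r * cis t) * Cconj (Ci * (r * cis t)))%C).
  + exact (proj2 (h _ _ _ (is_derive_curve_angle a r t))).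
  + unfold Ci, cis, Re, Im; simpl; ring.
- intros t; apply (continuous_mult (K := R_AbsRing)); [apply continuous_const|].
  apply (continuous_minus (V := R_NormedModule)); auto.
- unfold cis; now rewrite cos_2PI, sin_2PI, cos_0, sin_0.
Qed.

(** The two Wirtinger terms have equal means, so the conjugate derivative disappears; [dirichlet]
    can therefore leave it existential. *)
Lemma is_derive_avg (p p1 p2 : C -> C) (a : C) (r : R) :
  is_wirtinger p p1 p2 -> r <> 0 ->
  is_derive (fun r : R => avg (fun t => Re (p (a + r * cis t)%C))) r
    (2 * avg (fun t => Re (p1 (a + r * cis t) * cis t)%C)).
Proof.
intros h hr; generalize (avg_derivative_raw _ _ _ a r h).
destruct (h) as (c1 & c2 & c & _).
rewrite avg_plus by auto using avg_circle_Re_cis, avg_circle_Re_conj_cis.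
rewrite <- (avg_wirtinger_eq _ _ _ a r h hr).
now replace (_ + _) with (2 * avg (fun t => Re (p1 (a + r * cis t) * cis t)%C)) by ring.
Qed.

Lemma continuity_avg (p p1 p2 : C -> C) (a : C) (r : R) :
  is_wirtinger p p1 p2 ->
  continuity_pt (fun r => avg (fun t => Re (p (a + r * cis t)%C))) r.
Proof.
intros h; apply continuity_pt_filterlim, (ex_derive_continuous (V := R_NormedModule)).
eexists; now apply (avg_derivative_raw p p1 p2).
Qed.

Lemma avg_radius_0 (p : C -> C) (a : C) :
  avg (fun t => Re (p (a + 0 * cis t)%C)) = Re (p a).
Proof.
rewrite (avg_ext _ (fun _ => Re (p a))); [apply avg_const|].
intros t; now replace (a + 0 * cis t)%C with a by ring.
Qed.

(* On the circle of radius [r] about [a], [conj (z - a)] is [r * conj (cis t)]; substituting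
   [p z * conj (z - a)] for [p] in [is_derive_avg] therefore gives [is_derive_avg_conj]. *)
Lemma wirtinger_recenter (p p1 p2 : C -> C) (a : C) :
  is_wirtinger p p1 p2 ->
  is_wirtinger (fun z => p z * (Cconj z + - Cconj a))%C
    (fun z => p1 z * (Cconj z + - Cconj a))%C
    (fun z => p2 z * (Cconj z + - Cconj a) + p z)%C.
Proof.
intros h.
generalize (is_wirtinger_mult _ _ _ _ _ _ h
  (is_wirtinger_plus _ _ _ _ _ _ is_wirtinger_conj (is_wirtinger_const (- Cconj a)%C))).
apply is_wirtinger_ext; intros; unfold zeroC; ring.
Qed.

Lemma conj_circle (a : C) (r t : R) :
  (Cconj (a + r * cis t) + - Cconj a)%C = (r * Cconj (cis t))%C.
Proof. rewrite Cplus_conj, Cmult_conj; unfold RtoC, Cconj at 2; simpl; rewrite Ropp_0; ring. Qed.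

Lemma cis_conj (t : R) : (Cconj (cis t) * cis t)%C = RtoC 1.
Proof.
unfold cis, Cconj, Cmult, RtoC; simpl; f_equal; [|ring].
generalize (sin2_cos2 t); unfold Rsqr; lra.
Qed.

Lemma avg_recenter (p : C -> C) (a : C) (r : R) : contC p ->
  avg (fun t => Re (p (a + r * cis t) * (Cconj (a + r * cis t) + - Cconj a))%C) =
  r * avg (fun t => Re (p (a + r * cis t) * Cconj (cis t))%C).
Proof.
intros hp; rewrite <- avg_scal by now apply avg_circle_Re_conj_cis.
apply avg_ext; intros t; rewrite conj_circle, <- re_scal_l; f_equal; ring.
Qed.

Lemma is_derive_avg_conj (p p1 p2 : C -> C) (a : C) (r : R) :
  is_wirtinger p p1 p2 -> r <> 0 ->
  is_derive (fun r : R => r * avg (fun t => Re (p (a + r * cis t) * Cconj (cis t))%C)) r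
    (2 * r * avg (fun t => Re (p1 (a + r * cis t)%C))).
Proof.
intros h hr; destruct (h) as (c1 & c2 & c & _).
generalize (is_derive_avg _ _ _ a r (wirtinger_recenter p p1 p2 a h) hr).
intros k.
apply (is_derive_ext _ _ _ _ (fun s => avg_recenter p a s c)) in k.
replace (2 * r * _) with (2 * avg (fun t => Re (p1 (a + r * cis t) *
    (Cconj (a + r * cis t) + - Cconj a) * cis t)%C)); [exact k|].
rewrite Rmult_assoc, <- (avg_scal r) by now apply contC_circle.
f_equal; apply avg_ext; intros t; rewrite conj_circle, <- re_scal_l; f_equal.
replace (p1 (a + r * cis t) * (r * Cconj (cis t)) * cis t)%C with
  (p1 (a + r * cis t) * r * (Cconj (cis t) * cis t))%C by ring.
rewrite cis_conj; ring.
Qed.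

Lemma continuity_avg_conj (p p1 p2 : C -> C) (a : C) (r : R) :
  is_wirtinger p p1 p2 ->
  continuity_pt (fun r => r * avg (fun t => Re (p (a + r * cis t) * Cconj (cis t))%C)) r.
Proof.
intros h; destruct (h) as (c1 & c2 & c & _).
apply (continuity_pt_ext _ _ _ (fun s => avg_recenter p a s c)).
exact (continuity_avg _ _ _ a r (wirtinger_recenter p p1 p2 a h)).
Qed.

(** The derivative is asked for at positive radii only, since [is_derive_avg] excludes the radius 0;
    continuity closes the gap at the center. *)
Lemma increment_le (phi dphi : R -> R) (r K : R) : 0 <= r ->
  (forall s, 0 < s -> is_derive phi s (dphi s)) ->
  (forall s, 0 <= s <= r -> continuity_pt phi s) ->
  (forall s, 0 < s < r -> Rabs (dphi s) <= K) ->
  Rabs (phi r - phi 0) <= K * r.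
Proof.
intros [hr|<-] hd hc hK.
2:{ rewrite Rminus_diag, Rabs_R0; lra. }
assert (pr : forall c, 0 < c < r -> derivable_pt phi c).
{ intros c [h _]; exists (dphi c); now apply is_derive_Reals, hd. }
destruct (MVT phi id 0 r pr (fun c _ => derivable_pt_id c) hr hc) as (c & hcr & e).
{ intros; apply derivable_continuous_pt, derivable_pt_id. }
rewrite (derive_pt_id c) in e; unfold id in e.
assert (e' : derive_pt phi c (pr c hcr) = dphi c).
{ apply derive_pt_eq_0, is_derive_Reals, hd; lra. }
rewrite e' in e.
replace (phi r - phi 0) with (r * dphi c) by lra.
rewrite Rabs_mult, (Rabs_pos_eq r) by lra.
generalize (hK c hcr); nra.
Qed.

(** This serves with three kinds of [K]: a sup norm in the barrier argument, a small constant in the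
    passage to the limit, and 0 for the mean value property of holomorphic functions. *)
Lemma avg_increment_le (p p1 p2 : C -> C) (a : C) (r K : R) :
  is_wirtinger p p1 p2 -> 0 <= r ->
  (forall s, 0 < s < r -> Rabs (avg (fun t => Re (p1 (a + s * cis t) * cis t)%C)) <= K) ->
  Rabs (avg (fun t => Re (p (a + r * cis t)%C)) - Re (p a)) <= 2 * K * r.
Proof.
intros h hr hK; rewrite <- (avg_radius_0 p a) at 1.
apply (increment_le (fun r => avg (fun t => Re (p (a + r * cis t)%C)))
  (fun r => 2 * avg (fun t => Re (p1 (a + r * cis t) * cis t)%C))); auto.
- intros s hs; apply (is_derive_avg p p1 p2); auto; lra.
- intros s _; now apply (continuity_avg p p1 p2).
- intros s hs; rewrite Rabs_mult, (Rabs_pos_eq 2) by lra.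
  generalize (hK s hs); lra.
Qed.

(** Cauchy's theorem on a circle for a function with a holomorphic primitive: the conjugate side of
    [avg_wirtinger_eq] is zero. *)
Lemma avg_antiderivative (p p1 : C -> C) (a : C) (r : R) :
  is_wirtinger p p1 zeroC -> r <> 0 ->
  avg (fun t => Re (p1 (a + r * cis t) * cis t)%C) = 0.
Proof.
intros h hr; rewrite (avg_wirtinger_eq _ _ _ a r h hr).
rewrite (avg_ext _ (fun _ => 0)); [apply avg_const|].
intros t; unfold zeroC; simpl; ring.
Qed.

Lemma avg_holomorphic (p p1 : C -> C) (a : C) (r : R) :
  is_wirtinger p p1 zeroC -> 0 <= r ->
  avg (fun t => Re (p (a + r * cis t)%C)) = Re (p a).
Proof.
intros h hr; apply Rminus_diag_uniq.
assert (k : Rabs (avg (fun t => Re (p (a + r * cis t)%C)) - Re (p a)) <= 2 * 0 * r).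
{ apply (avg_increment_le p p1 zeroC); auto.
  intros s hs; rewrite (avg_antiderivative p p1 a s h), Rabs_R0; lra. }
apply Rabs_le_between in k; lra.
Qed.
(** * A maximum principle on the unit disc *)

Lemma cont_Cmod : cont Cmod.
Proof.
intros z; unfold Cmod.
apply (continuous_comp (fun z : C => fst z ^ 2 + snd z ^ 2) sqrt); [|apply continuous_sqrt].
apply (cont_ext (fun z => Re z * Re z + Im z * Im z)); [intros w; unfold Re, Im; ring|].
apply cont_plus; apply cont_mult; auto using cont_Re, cont_Im.
Qed.

Lemma continuous_Rmax1 (x : R) : continuous (Rmax 1) x.
Proof.
apply (continuous_ext (fun y => (1 + y + Rabs (y - 1)) / 2)).
{ intros y; unfold Rmax; destruct (Rle_dec 1 y);
  [rewrite Rabs_pos_eq|rewrite Rabs_left]; lra. }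
apply (continuous_mult (K := R_AbsRing)); [|apply continuous_const].
apply (continuous_plus (V := R_NormedModule)).
- apply (continuous_plus (V := R_NormedModule)); [apply continuous_const|apply continuous_id].
- apply continuous_Rabs_comp, (continuous_minus (V := R_NormedModule));
    [apply continuous_id|apply continuous_const].
Qed.

(** The radial retraction onto the closed unit disc. *)
Definition disc_proj (z : C) : C := (RtoC (/ Rmax 1 (Cmod z)) * z)%C.

Lemma contC_RtoC (G : C -> R) : cont G -> contC (fun z => RtoC (G z)).
Proof. intros h; split; [exact h|exact (cont_const 0)]. Qed.

Lemma Rmax1_pos (x : R) : 0 < Rmax 1 x.
Proof. generalize (Rmax_l 1 x); lra. Qed.

Lemma contC_disc_proj : contC disc_proj.
Proof.
apply contC_mult; [|apply contC_id].
apply contC_RtoC; intros z.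
apply (continuous_comp (fun z => Rmax 1 (Cmod z)) Rinv); [|apply continuous_Rinv].
- apply (continuous_comp Cmod (Rmax 1)); [apply cont_Cmod|apply continuous_Rmax1].
- generalize (Rmax1_pos (Cmod z)); lra.
Qed.

Lemma disc_proj_le (z : C) : Cmod (disc_proj z) <= 1.
Proof.
unfold disc_proj; rewrite Cmod_mult, Cmod_R.
assert (h := Rmax1_pos (Cmod z)); assert (k := Rmax_r 1 (Cmod z)).
rewrite Rabs_pos_eq by (left; now apply Rinv_0_lt_compat).
apply (Rmult_le_reg_l (Rmax 1 (Cmod z))); auto.
rewrite <- Rmult_assoc, Rinv_r by lra; lra.
Qed.

Lemma disc_proj_id (z : C) : Cmod z <= 1 -> disc_proj z = z.
Proof.
intros h; unfold disc_proj; rewrite Rmax_left by assumption.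
rewrite Rinv_1; ring.
Qed.

Lemma cont_2d (G : C -> R) (x y : R) : cont G -> continuity_2d_pt (fun x y => G (x, y)) x y.
Proof.
intros h; apply continuity_2d_pt_filterlim.
apply (continuous_ext G (fun z : R * R => G (fst z, snd z)) (x, y)); [now intros [u v]|apply h].
Qed.

Lemma Rabs_Re_le (z : C) : Rabs (Re z) <= Cmod z.
Proof. apply re_le_Cmod. Qed.

Lemma Rabs_Im_le (z : C) : Rabs (Im z) <= Cmod z.
Proof. eapply Rle_trans; [apply Rmax_r|apply Rmax_Cmod]. Qed.

(** If the supremum [s] were not attained, each point would have a radius [d], at most half its gap
    to [s], within which [H] stays below [s] by that half gap. Compactness bounds these radii below
    by one [m > 0], and [s - m] would be a smaller upper bound. *)
Lemma square_max (H : C -> R) : cont H -> (exists B, forall z, H z <= B) ->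
  exists u v, -1 <= u <= 1 /\ -1 <= v <= 1 /\
    forall x y, -1 <= x <= 1 -> -1 <= y <= 1 -> H (x, y) <= H (u, v).
Proof.
intros hc [B hB].
set (E := fun h => exists u v, -1 <= u <= 1 /\ -1 <= v <= 1 /\ h = H (u, v)).
destruct (completeness E) as [s [hs1 hs2]].
- exists B; intros h (u & v & _ & _ & ->); apply hB.
- exists (H (0, 0)), 0, 0; repeat split; lra.
- apply NNPP; intros hn.
  assert (hlt : forall u v, -1 <= u <= 1 -> -1 <= v <= 1 -> H (u, v) < s).
  { intros u v hu hv; destruct (hs1 (H (u, v))) as [l|e]; auto; [now exists u, v|].
    exfalso; apply hn; exists u, v; split; [|split]; auto.
    intros x y hx hy; rewrite e; apply hs1; now exists x, y. }
  assert (hd : forall u v, exists d : posreal, -1 <= u <= 1 -> -1 <= v <= 1 ->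
    d <= (s - H (u, v)) / 2 /\ forall x y, Rabs (x - u) < d -> Rabs (y - v) < d ->
      H (x, y) <= H (u, v) + (s - H (u, v)) / 2).
  { intros u v.
    destruct (classic (-1 <= u <= 1 /\ -1 <= v <= 1)) as [[hu hv]|no].
    2:{ exists (mkposreal 1 Rlt_0_1); tauto. }
    assert (hp := hlt u v hu hv).
    assert (he : 0 < (s - H (u, v)) / 2) by lra.
    destruct (cont_2d H u v hc (mkposreal _ he)) as [d k]; simpl in k.
    exists (mkposreal _ (Rmin_stable_in_posreal d (mkposreal _ he))); simpl.
    intros _ _; split; [apply Rmin_r|].
    intros x y h1 h2.
    assert (k' := k x y (Rlt_le_trans _ _ _ h1 (Rmin_l _ _)) (Rlt_le_trans _ _ _ h2 (Rmin_l _ _))).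
    apply Rabs_def2 in k'; lra. }
  set (d := fun u v => proj1_sig (constructive_indefinite_description _ (hd u v))).
  destruct (compactness_value_2d (-1) 1 (-1) 1 d) as [m hm].
  assert (s <= s - m); [|destruct m; simpl in *; lra].
  apply hs2; intros h (x & y & hx & hy & ->).
  apply Rnot_lt_le; intros hlt'.
  apply (hm x y hx hy); intros (u & v & hu & hv & h1 & h2 & h3).
  unfold d in *; destruct (constructive_indefinite_description _ (hd u v)) as [e he]; simpl in *.
  destruct (he hu hv) as [k1 k2].
  generalize (k2 x y h1 h2); lra.
Qed.

(** Carried over from the square by [disc_proj]; [atan], increasing and bounded, supplies the upper
    bound that [square_max] asks for. *)
Lemma disc_max (G : C -> R) : cont G ->
  exists a, Cmod a <= 1 /\ forall z, Cmod z <= 1 -> G z <= G a.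
Proof.
intros hG.
destruct (square_max (fun z => atan (G (disc_proj z)))) as (u & v & _ & _ & h).
- apply (cont_comp atan (fun z => G (disc_proj z))).
  + intros x; apply continuity_pt_filterlim, derivable_continuous_pt, derivable_pt_atan.
  + apply cont_compC; auto; apply contC_disc_proj.
- exists (PI / 2); intros z; left; apply atan_bound.
- exists (disc_proj (u, v)); split; [apply disc_proj_le|].
  intros [x y] hz.
  generalize (Rabs_Re_le (x, y)), (Rabs_Im_le (x, y)); simpl; intros h1 h2.
  assert (k : atan (G (disc_proj (x, y))) <= atan (G (disc_proj (u, v)))).
  { apply h; apply Rabs_le_between; lra. }
  rewrite (disc_proj_id (x, y)) in k by assumption.
  apply Rnot_lt_le; intros hl; apply atan_increasing in hl; lra.
Qed.

Lemma Cmod_cis (t : R) : Cmod (cis t) = 1.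
Proof.
unfold Cmod, cis; simpl.
replace (_ + _) with 1; [now rewrite sqrt_1|].
generalize (sin2_cos2 t); unfold Rsqr; lra.
Qed.

Lemma Cmod_circle_le (a : C) (r t : R) : 0 <= r -> Cmod (a + r * cis t)%C <= Cmod a + r.
Proof.
intros hr; eapply Rle_trans; [apply Cmod_triangle|].
rewrite Cmod_mult, Cmod_R, Rabs_pos_eq, Cmod_cis by assumption; lra.
Qed.

Lemma Cmod_circle_ge (a : C) (r t : R) : 0 <= r -> Cmod a <= Cmod (a + r * cis t)%C + r.
Proof.
intros hr; replace a with ((a + r * cis t) + - (r * cis t))%C at 1 by ring.
eapply Rle_trans; [apply Cmod_triangle|].
rewrite Cmod_opp, Cmod_mult, Cmod_R, Rabs_pos_eq, Cmod_cis by assumption; lra.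
Qed.

(** At a maximum point no mean exceeds the value, so one circle per point is enough. Its radius is
    left free: the barrier argument takes it comparable to the distance to the boundary, the
    Blaschke-Privalov argument takes it small. *)
Lemma max_principle (G : C -> R) : cont G ->
  (forall z, Cmod z = 1 -> G z <= 0) ->
  (forall a, Cmod a < 1 -> 0 < G a -> exists r, 0 < r <= 1 - Cmod a /\
     G a < avg (fun t => G (a + r * cis t)%C)) ->
  forall z, Cmod z <= 1 -> G z <= 0.
Proof.
intros hG hb hi z hz.
destruct (disc_max G hG) as (a & ha & hmax).
apply Rle_trans with (G a); auto.
apply Rnot_lt_le; intros hpos.
assert (ha1 : Cmod a < 1).
{ destruct ha as [l|e]; auto; generalize (hb a e); lra. }
destruct (hi a ha1 hpos) as (r & hr & hlt).
apply (Rlt_not_le _ _ hlt); rewrite <- (avg_const (G a)) at 1.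
apply avg_le.
- intros t; now apply cont_circle.
- intros t; apply continuous_const.
- intros t; apply hmax.
  generalize (Cmod_circle_le a r t); lra.
Qed.

(** * A barrier *)

(** The terms in [c3] and [c4] are [cos (2 * t)] and half of [sin (2 * t)]; the oscillating part has
    an explicit periodic primitive. *)
Lemma avg_trig (c0 c1 c2 c3 c4 : R) :
  avg (fun t => c0 + (c1 * cos t + c2 * sin t +
    c3 * (cos t * cos t - sin t * sin t) + c4 * (sin t * cos t))) = c0.
Proof.
set (psi := fun t => c1 * cos t + c2 * sin t +
    c3 * (cos t * cos t - sin t * sin t) + c4 * (sin t * cos t)).
assert (hc : continuous1 psi).
{ intros t; apply (ex_derive_continuous (V := R_NormedModule)); unfold psi; auto_derive; auto. }
change (avg (fun t => c0 + psi t) = c0).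
rewrite (avg_plus (fun _ => c0) psi); auto; [|intros t; apply continuous_const].
rewrite avg_const, (avg_period
  (fun t => c1 * sin t - c2 * cos t + c3 * (sin t * cos t) + c4 * (sin t * sin t) / 2) psi); auto.
- ring.
- intros t; unfold psi; auto_derive; auto; field.
- rewrite cos_2PI, sin_2PI, cos_0, sin_0; ring.
Qed.

(** Its circle means fall short of the central value by exactly [r * r], the scale of the little-oh
    hypothesis. *)
Definition defect (z : C) : R := 1 - (Re z * Re z + Im z * Im z).

(** A multiple of [defect] loses order [r * r], too little against an error of order [r] near the
    boundary; its square root loses a multiple of [r]. Outside the disc [sqrt] of a negative number
    is 0, which keeps the function continuous on the plane. *)
Definition barrier (z : C) : R := sqrt (defect z).

Lemma cont_defect : cont defect.
Proof.
apply cont_minus; [apply cont_const|].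
apply cont_plus; apply cont_mult; auto using cont_Re, cont_Im.
Qed.

Lemma cont_barrier : cont barrier.
Proof. apply cont_comp; [apply continuous_sqrt|apply cont_defect]. Qed.

Lemma Cmod_sq (z : C) : Cmod z * Cmod z = Re z * Re z + Im z * Im z.
Proof.
unfold Cmod; rewrite sqrt_sqrt; [unfold Re, Im; ring|].
generalize (pow2_ge_0 (fst z)), (pow2_ge_0 (snd z)); lra.
Qed.

Lemma defect_eq (z : C) : defect z = 1 - Cmod z * Cmod z.
Proof. unfold defect; now rewrite Cmod_sq. Qed.

Lemma avg_defect (a : C) (r : R) :
  avg (fun t => defect (a + r * cis t)%C) = defect a - r * r.
Proof.
rewrite <- (avg_trig (defect a - r * r) (- 2 * r * Re a) (- 2 * r * Im a) 0 0).
apply avg_ext; intros t; rewrite circle_pt; unfold defect, Re, Im; simpl.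
generalize (sin2_cos2 t); unfold Rsqr; intros h.
replace (sin t * sin t) with (1 - cos t * cos t) by lra.
replace (r * r) with (r * r * (sin t * sin t + cos t * cos t)) by (rewrite h; ring).
ring.
Qed.

Lemma avg_defect_sq (a : C) (r : R) :
  avg (fun t => (defect (a + r * cis t)%C - defect a) * (defect (a + r * cis t)%C - defect a)) =
  2 * (r * r) * (Re a * Re a + Im a * Im a) + r * r * (r * r).
Proof.
rewrite <- (avg_trig (2 * (r * r) * (Re a * Re a + Im a * Im a) + r * r * (r * r))
  (4 * (r * r * r) * Re a) (4 * (r * r * r) * Im a)
  (2 * (r * r) * (Re a * Re a - Im a * Im a)) (8 * (r * r) * (Re a * Im a))).
apply avg_ext; intros t; rewrite circle_pt; unfold defect, Re, Im; simpl.
destruct a as [x y]; simpl.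
generalize (sin2_cos2 t); unfold Rsqr; intros h.
set (c := cos t) in *; set (s := sin t) in *.
assert (e : s * s = 1 - c * c) by lra.
replace (1 - ((x + r * c) * (x + r * c) + (y + r * s) * (y + r * s)) - (1 - (x * x + y * y)))
  with (- (2 * r * (x * c + y * s) + r * r * (s * s + c * c))) by ring.
rewrite h.
transitivity (4 * (r * r) * (x * x * (c * c) + 2 * (x * y) * (s * c) + y * y * (s * s))
  + 4 * (r * r * r) * (x * c + y * s) + r * r * (r * r)); [ring|].
rewrite e; ring.
Qed.

(* With [x = sqrt q / s] this is [x <= 1 + (x^2 - 1) / 2 - (x^2 - 1)^2 / 18], which holds as
   [(x + 1)^2 <= 9]. *)
Lemma sqrt_le_parabola (s q : R) : 0 < s -> 0 <= q <= 4 * (s * s) ->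
  sqrt q <= s + (q - s * s) / (2 * s) - (q - s * s) * (q - s * s) / (18 * (s * s * s)).
Proof.
intros hs hq.
assert (h0 := sqrt_pos q); assert (h1 := sqrt_sqrt q (proj1 hq)).
assert (h2 : sqrt q <= 2 * s).
{ apply Rsqr_incr_0_var; unfold Rsqr; nra. }
set (x := sqrt q) in *; rewrite <- h1.
apply Rminus_le_0.
replace (_ - x) with ((x - s) * (x - s) * (9 * (s * s) - (x + s) * (x + s)) / (18 * (s * s * s)))
  by (field; now apply Rgt_not_eq).
apply Rmult_le_pos.
- apply Rmult_le_pos; [apply Rle_0_sqr|].
  replace (_ - _) with ((2 * s - x) * (4 * s + x)) by ring; apply Rmult_le_pos; lra.
- left; apply Rinv_0_lt_compat; repeat apply Rmult_lt_0_compat; lra.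
Qed.

(** On this circle [defect] lies between 0 and four times its central value [s * s], so the parabola
    of [sqrt_le_parabola] may be averaged instead of the root. Near the boundary, where [s * s] is
    of order [r], the quadratic term, of order [r * r] over the cube of [s], provides the loss; near
    the center the linear term suffices. *)
Lemma avg_barrier (a : C) (r : R) : Cmod a < 1 -> r = (1 - Cmod a) / 2 ->
  avg (fun t => barrier (a + r * cis t)%C) <= barrier a - r / 36.
Proof.
intros ha hr.
assert (hm := Cmod_ge_0 a).
assert (hs : 0 < barrier a).
{ apply sqrt_lt_R0; rewrite defect_eq; nra. }
assert (hss : barrier a * barrier a = defect a).
{ apply sqrt_sqrt; rewrite defect_eq; nra. }
set (s := barrier a) in *.
set (k1 := / (2 * s)); set (k2 := / (18 * (s * s * s))).
assert (hcd : continuous1 (fun t => defect (a + r * cis t)%C - defect a)).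
{ intros t; apply (cont_circle (fun z => defect z - defect a)).
  apply cont_minus; [apply cont_defect|apply cont_const]. }
assert (hcq : continuous1 (fun t => (defect (a + r * cis t)%C - defect a) *
   (defect (a + r * cis t)%C - defect a))).
{ intros t; apply (continuous_mult (K := R_AbsRing)); auto. }
assert (hcd' : continuous1 (fun t => defect (a + r * cis t)%C)).
{ intros t; apply (cont_circle defect), cont_defect. }
assert (hcc : forall c, continuous1 (fun _ => c)) by (intros c t; apply continuous_const).
apply Rle_trans with (avg (fun t => s + (k1 * (defect (a + r * cis t)%C - defect a) -
  k2 * ((defect (a + r * cis t)%C - defect a) * (defect (a + r * cis t)%C - defect a))))).
- apply avg_le.
  + intros t; apply (cont_circle barrier), cont_barrier.
  + intros t; apply (continuous_plus (V := R_NormedModule)); [apply hcc|].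
    apply (continuous_minus (V := R_NormedModule)); apply (continuous_mult (K := R_AbsRing));
      first [exact (hcc _ t)|exact (hcd t)|exact (hcq t)].
  + intros t.
    assert (hz := Cmod_circle_le a r t ltac:(lra)).
    assert (hz0 := Cmod_ge_0 (a + r * cis t)%C).
    assert (hz1 := Cmod_circle_ge a r t ltac:(lra)).
    rewrite <- hss.
    eapply Rle_trans; [apply (sqrt_le_parabola s)|]; auto.
    * rewrite hss, !defect_eq; split; nra.
    * right; unfold k1, k2; field; now apply Rgt_not_eq.
- rewrite avg_plus, avg_const, avg_minus, !avg_scal, avg_minus, avg_const, avg_defect, avg_defect_sq;
    auto; try (intros t; apply (continuous_mult (K := R_AbsRing));
      first [exact (hcc _ t)|exact (hcd t)|exact (hcq t)]).
  2:{ intros t; apply (continuous_minus (V := R_NormedModule)); apply (continuous_mult (K := R_AbsRing));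
      first [exact (hcc _ t)|exact (hcd t)|exact (hcq t)]. }
  rewrite <- Cmod_sq; rewrite defect_eq in hss |- *.
  set (m := Cmod a) in *.
  assert (hr0 : 0 < r) by lra.
  apply Rminus_le_0.
  replace (_ - _) with (r * ((9 * r * (s * s) + m * m * (2 * r) + r * r * r - s * s * s / 2)
     / (18 * (s * s * s)))) by (unfold k1, k2; field; now apply Rgt_not_eq).
  (* Since [s * s = (1 - m) * (1 + m)] is at most [4 * r], the bracket is at least half of
     [s * s - s * s * s] plus nonnegative terms. The loss [r / 36] is the term [s * s * s / 2] over
     [18 * (s * s * s)]. *)
  assert (h1 : s * s <= 4 * r) by nra.
  assert (h2 : s <= 1) by nra.
  apply Rmult_le_pos; [lra|].
  apply Rmult_le_pos; [|left; apply Rinv_0_lt_compat; repeat apply Rmult_lt_0_compat; lra].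
  assert (h3 : 0 <= r * r * r) by (repeat apply Rmult_le_pos; lra).
  assert (h4 : s * s * s <= s * s) by nra.
  assert (h5 : m * m * (s * s) <= m * m * (4 * r)) by (apply Rmult_le_compat_l; nra).
  assert (h6 : s * s * (s * s) <= s * s * (4 * r)) by (apply Rmult_le_compat_l; nra).
  assert (h7 : m * m = 1 - s * s) by lra.
  rewrite h7 in *; nra.
Qed.
(** * The Dirichlet problem for polynomials *)

(* [D n] is the [n]-th derivative of a holomorphic function [D 0]; the function [w] vanishes on
   the unit circle, and its [z]-derivative differs from [f] by the holomorphic [D 1]. *)
Definition dirichlet (f w : C -> C) (D : nat -> C -> C) : Prop :=
  contC f /\ (forall n, is_wirtinger (D n) (D (S n)) zeroC) /\
  (exists w2, is_wirtinger w (fun z => f z + - D 1%nat z)%C w2) /\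
  (forall z, Cmod z = 1 -> w z = RtoC 0).

Lemma dirichlet_plus (f w : C -> C) (D : nat -> C -> C) (g v : C -> C) (E : nat -> C -> C) :
  dirichlet f w D -> dirichlet g v E ->
  dirichlet (fun z => f z + g z)%C (fun z => w z + v z)%C (fun n z => D n z + E n z)%C.
Proof.
intros (cf & hD & [w2 hw] & bw) (cg & hE & [v2 hv] & bv); split; [|split; [|split]].
- now apply contC_plus.
- intros n; generalize (is_wirtinger_plus _ _ _ _ _ _ (hD n) (hE n)).
  apply is_wirtinger_ext; intros; unfold zeroC; ring.
- exists (fun z => w2 z + v2 z)%C; generalize (is_wirtinger_plus _ _ _ _ _ _ hw hv).
  apply is_wirtinger_ext; intros; ring.
- intros z hz; rewrite (bw z hz), (bv z hz); ring.
Qed.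

Lemma dirichlet_scal (c : C) (f w : C -> C) (D : nat -> C -> C) :
  dirichlet f w D ->
  dirichlet (fun z => c * f z)%C (fun z => c * w z)%C (fun n z => c * D n z)%C.
Proof.
intros (cf & hD & [w2 hw] & bw); split; [|split; [|split]].
- apply contC_mult; auto; apply contC_const.
- intros n; generalize (is_wirtinger_scal c _ _ _ (hD n)).
  apply is_wirtinger_ext; intros; unfold zeroC; ring.
- exists (fun z => c * w2 z)%C; generalize (is_wirtinger_scal c _ _ _ hw).
  apply is_wirtinger_ext; intros; ring.
- intros z hz; rewrite (bw z hz); ring.
Qed.

Lemma dirichlet_ext (f g w : C -> C) (D : nat -> C -> C) :
  (forall z, f z = g z) -> dirichlet f w D -> dirichlet g w D.
Proof.
intros e (cf & hD & [w2 hw] & bw); split; [now apply (contC_ext f)|split; [|split]]; auto.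
exists w2; revert hw; apply is_wirtinger_ext; auto; intros; now rewrite e.
Qed.

Lemma dirichlet_minus (f w : C -> C) (D : nat -> C -> C) (g v : C -> C) (E : nat -> C -> C) :
  dirichlet f w D -> dirichlet g v E ->
  exists H, dirichlet (fun z => f z - g z)%C (fun z => w z + RtoC (-1) * v z)%C H.
Proof.
intros h k; exists (fun n z => D n z + RtoC (-1) * E n z)%C.
apply (dirichlet_ext (fun z => f z + RtoC (-1) * g z)%C); [intros; ring|].
apply dirichlet_plus; auto; now apply dirichlet_scal.
Qed.

Lemma is_wirtinger_pow (n : nat) :
  is_wirtinger (fun z => z ^ S n)%C (fun z => RtoC (INR (S n)) * z ^ n)%C zeroC.
Proof.
induction n as [|n IH].
- generalize is_wirtinger_id; apply is_wirtinger_ext; intros; simpl; ring.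
- generalize (is_wirtinger_mult _ _ _ _ _ _ is_wirtinger_id IH).
  apply is_wirtinger_ext; intros z; unfold zeroC; rewrite ?S_INR, ?RtoC_plus; simpl; ring.
Qed.

Lemma is_wirtinger_conj_pow (n : nat) :
  exists q, is_wirtinger (fun z => Cconj z ^ n)%C zeroC q.
Proof.
induction n as [|n [q IH]].
- exists zeroC; generalize (is_wirtinger_const (RtoC 1)).
  apply is_wirtinger_ext; intros; reflexivity.
- exists (fun z => 1 * Cconj z ^ n + Cconj z * q z)%C.
  generalize (is_wirtinger_mult _ _ _ _ _ _ is_wirtinger_conj IH).
  apply is_wirtinger_ext; intros z; unfold zeroC; simpl; ring.
Qed.

Lemma pow_derivatives (m : nat) (c : C) : exists D : nat -> C -> C,
  (forall z, D 0%nat z = c * z ^ m)%C /\ forall n, is_wirtinger (D n) (D (S n)) zeroC.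
Proof.
revert c; induction m as [|m IH]; intros c.
- exists (fun n => match n with O => fun _ => c | _ => zeroC end); split.
  + intros z; simpl; ring.
  + intros [|n]; apply is_wirtinger_const.
- destruct (IH (c * RtoC (INR (S m)))%C) as (D & h0 & hD).
  exists (fun n => match n with O => fun z => c * z ^ S m | S k => D k end)%C; split.
  + reflexivity.
  + intros [|n]; auto.
    generalize (is_wirtinger_scal c _ _ _ (is_wirtinger_pow m)).
    apply is_wirtinger_ext; intros z; auto; [|unfold zeroC; ring].
    rewrite h0; ring.
Qed.

Lemma conj_circle_inv (z : C) : Cmod z = 1 -> (z * Cconj z)%C = RtoC 1.
Proof. intros h; rewrite <- Cmod2_conj, h, RtoC_pow; ring. Qed.

Lemma Cpow_conj_cancel (z : C) (j k : nat) : Cmod z = 1 ->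
  (z ^ (j + k) * Cconj z ^ k)%C = (z ^ j)%C /\ (z ^ k * Cconj z ^ (k + j))%C = (Cconj z ^ j)%C.
Proof.
intros h; assert (e : (z ^ k * Cconj z ^ k)%C = RtoC 1).
{ rewrite <- Cpow_mult_l, conj_circle_inv, Cpow_1_l; auto. }
rewrite !Cpow_add_r; split.
- transitivity (z ^ j * (z ^ k * Cconj z ^ k))%C; [ring|rewrite e; ring].
- transitivity ((z ^ k * Cconj z ^ k) * Cconj z ^ j)%C; [ring|rewrite e; ring].
Qed.

Lemma dirichlet_monomial (c : C) (j k : nat) :
  exists w D, dirichlet (fun z => c * z ^ j * Cconj z ^ k)%C w D.
Proof.
set (b := (c * RtoC (/ INR (S j)))%C).
assert (hb : (b * RtoC (INR (S j)))%C = c).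
{ unfold b; rewrite <- Cmult_assoc, <- RtoC_mult, Rinv_l by (apply not_0_INR; lia); ring. }
destruct (is_wirtinger_conj_pow k) as [q hq].
assert (hu := is_wirtinger_scal b _ _ _ (is_wirtinger_mult _ _ _ _ _ _ (is_wirtinger_pow j) hq)).
cbv beta in hu.
assert (hf : contC (fun z => c * z ^ j * Cconj z ^ k)%C).
{ destruct hu as [hu _]; revert hu; apply contC_ext.
  intros z; rewrite <- hb at 1; unfold zeroC; ring. }
destruct (Nat.le_gt_cases k j) as [l|l].
- destruct (pow_derivatives (S (j - k)) b) as (D & h0 & hD).
  exists (fun z => b * (z ^ S j * Cconj z ^ k) + RtoC (-1) * D 0%nat z)%C, D.
  split; [|split; [|split]]; auto.
  + eexists; generalize (is_wirtinger_plus _ _ _ _ _ _ hu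
      (is_wirtinger_scal (RtoC (-1)) _ _ _ (hD 0%nat))).
    apply is_wirtinger_ext; [reflexivity| |reflexivity].
    intros z; rewrite <- hb; unfold zeroC; ring.
  + intros z hz; rewrite h0.
    replace (S j) with (S (j - k) + k)%nat by lia.
    rewrite (proj1 (Cpow_conj_cancel z (S (j - k)) k hz)); ring.
- destruct (is_wirtinger_conj_pow (k - S j)) as [q' hq'].
  exists (fun z => b * (z ^ S j * Cconj z ^ k) + (RtoC (-1) * b) * Cconj z ^ (k - S j))%C,
    (fun _ => zeroC).
  split; [|split; [|split]]; auto.
  + intros n; apply is_wirtinger_const.
  + eexists; generalize (is_wirtinger_plus _ _ _ _ _ _ hu
      (is_wirtinger_scal (RtoC (-1) * b)%C _ _ _ hq')).
    apply is_wirtinger_ext; [reflexivity| |reflexivity].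
    intros z; rewrite <- hb; unfold zeroC; ring.
  + intros z hz.
    replace k with (S j + (k - S j))%nat at 1 by lia.
    rewrite (proj2 (Cpow_conj_cancel z (k - S j) (S j) hz)); ring.
Qed.

(** Polynomials in [z] and its conjugate; the third constructor replaces an appeal to functional
    extensionality. *)
Inductive poly : (C -> C) -> Prop :=
| poly_monomial (c : C) (j k : nat) : poly (fun z => c * z ^ j * Cconj z ^ k)%C
| poly_plus (p q : C -> C) : poly p -> poly q -> poly (fun z => p z + q z)%C
| poly_ext (p q : C -> C) : (forall z, p z = q z) -> poly p -> poly q.

Lemma poly_dirichlet (p : C -> C) : poly p -> exists w D, dirichlet p w D.
Proof.
induction 1 as [c j k|p q _ (w & D & h) _ (v & E & k)|p q e _ (w & D & h)].
- apply dirichlet_monomial.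
- do 2 eexists; apply dirichlet_plus; eassumption.
- exists w, D; now apply (dirichlet_ext p).
Qed.

Lemma poly_mult (p q : C -> C) : poly p -> poly q -> poly (fun z => p z * q z)%C.
Proof.
intros hp hq; induction hp as [c j k|p p' _ h _ h'|p p' e _ h].
- induction hq as [d l m|q q' _ h _ h'|q q' e _ h].
  + apply (poly_ext (fun z => (c * d) * z ^ (j + l) * Cconj z ^ (k + m))%C);
      [intros; rewrite !Cpow_add_r; ring|apply poly_monomial].
  + refine (poly_ext _ _ _ (poly_plus _ _ h h')); intros; cbv beta; ring.
  + refine (poly_ext _ _ _ h); intros; cbv beta; now rewrite e.
- refine (poly_ext _ _ _ (poly_plus _ _ h h')); intros; cbv beta; ring.
- refine (poly_ext _ _ _ h); intros; cbv beta; now rewrite e.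
Qed.

Lemma poly_const (c : C) : poly (fun _ => c).
Proof.
apply (poly_ext (fun z => c * z ^ 0 * Cconj z ^ 0)%C); [intros; simpl; ring|apply poly_monomial].
Qed.

Lemma poly_Re : poly (fun z => RtoC (Re z)).
Proof.
apply (poly_ext (fun z => RtoC (/ 2) * z ^ 1 * Cconj z ^ 0 + RtoC (/ 2) * z ^ 0 * Cconj z ^ 1)%C).
- intros [x y]; unfold RtoC, Cconj, Cpow, Cmult, Cplus; simpl; f_equal; field.
- apply poly_plus; apply poly_monomial.
Qed.

Lemma poly_Im : poly (fun z => RtoC (Im z)).
Proof.
apply (poly_ext (fun z => (- RtoC (/ 2) * Ci) * z ^ 1 * Cconj z ^ 0 +
  (RtoC (/ 2) * Ci) * z ^ 0 * Cconj z ^ 1)%C).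
- intros [x y]; unfold RtoC, Ci, Cconj, Cpow, Cmult, Cplus, Copp; simpl; f_equal; field.
- apply poly_plus; apply poly_monomial.
Qed.

(** * The uniform bound *)

Lemma avg_Re_cis_minus (p q : C -> C) (a : C) (r : R) : contC p -> contC q ->
  avg (fun t => Re ((p (a + r * cis t) + - q (a + r * cis t)) * cis t)%C) =
  avg (fun t => Re (p (a + r * cis t) * cis t)%C) - avg (fun t => Re (q (a + r * cis t) * cis t)%C).
Proof.
intros hp hq; rewrite <- avg_minus by now apply avg_circle_Re_cis.
apply avg_ext; intros t.
replace ((p (a + r * cis t) + - q (a + r * cis t)) * cis t)%C with
  (p (a + r * cis t) * cis t + - (q (a + r * cis t) * cis t))%C by ring.
reflexivity.
Qed.

(** The correction [D 1] has the primitive [D 0], so it is invisible on circles. The means of [w]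
    are thus controlled by [f] alone, without any bound on [D 1]. *)
Lemma dirichlet_avg_cis (f w : C -> C) (D : nat -> C -> C) (a : C) (r : R) :
  dirichlet f w D -> r <> 0 ->
  avg (fun t => Re ((f (a + r * cis t) + - D 1%nat (a + r * cis t)) * cis t)%C) =
  avg (fun t => Re (f (a + r * cis t) * cis t)%C).
Proof.
intros (cf & hD & _) hr; rewrite avg_Re_cis_minus; auto.
- rewrite (avg_antiderivative _ _ a r (hD 0%nat) hr); ring.
- apply (hD 1%nat).
Qed.

Lemma Rabs_Re_cis_le (z : C) (t : R) : Rabs (Re (z * cis t)%C) <= Cmod z.
Proof. eapply Rle_trans; [apply Rabs_Re_le|]; rewrite Cmod_mult, Cmod_cis; lra. Qed.

(** The means of [Re w] move by at most [2 * S * r], while those of the barrier drop by at least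
    [r / 36]; 73 is the first integer beyond [2 * 36], which makes the inequality strict. *)
Lemma dirichlet_Re_le (f w : C -> C) (D : nat -> C -> C) (S : R) :
  dirichlet f w D -> 0 < S -> (forall z, Cmod z <= 1 -> Cmod (f z) <= S) ->
  forall z, Cmod z <= 1 -> Re (w z) <= 73 * S.
Proof.
intros h hS hf z hz.
destruct (h) as (cf & hD & [w2 hw] & bw).
assert (cw : contC w) by apply hw.
assert (hb : forall z, Cmod z <= 1 -> 0 <= barrier z <= 1).
{ intros x hx; unfold barrier; split; [apply sqrt_pos|].
  rewrite <- sqrt_1; apply sqrt_le_1_alt; rewrite defect_eq.
  generalize (Rle_0_sqr (Cmod x)); unfold Rsqr; lra. }
assert (hmax : forall z, Cmod z <= 1 -> Re (w z) - (73 * S) * barrier z <= 0).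
2:{ generalize (hmax z hz) (hb z hz); nra. }
clear z hz.
assert (ccb : cont (fun z => 73 * S * barrier z)).
{ apply cont_mult; [apply cont_const|apply cont_barrier]. }
apply max_principle.
- apply cont_minus; auto; apply cw.
- intros z hz; rewrite (bw z hz); simpl; generalize (hb z (or_intror hz)); nra.
- intros a ha _.
  set (r := (1 - Cmod a) / 2).
  assert (hm := Cmod_ge_0 a).
  exists r; split; [unfold r; lra|].
  rewrite avg_minus by (intros t; first [apply (cont_circle _ a r t (proj1 cw))|
     apply (cont_circle _ a r t ccb)]).
  rewrite avg_scal by (intros t; apply (cont_circle _ a r t cont_barrier)).
  generalize (avg_barrier a r ha eq_refl); intros h1.
  assert (h2 : Rabs (avg (fun t => Re (w (a + r * cis t)%C)) - Re (w a)) <= 2 * S * r).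
  { apply (avg_increment_le _ _ _ a r S hw); [unfold r; lra|].
    intros s hs; rewrite (dirichlet_avg_cis f w D); [|assumption|lra].
    apply avg_abs; [now apply avg_circle_Re_cis|].
    intros t; eapply Rle_trans; [apply Rabs_Re_cis_le|apply hf].
    generalize (Cmod_circle_le a s t); unfold r in hs; lra. }
  apply Rabs_le_between in h2.
  assert (hr : 0 < r) by (unfold r; lra).
  assert (h3 := Rmult_le_compat_l (73 * S) _ _ ltac:(lra) h1).
  assert (h4 : 0 < S * r) by nra.
  lra.
Qed.

(** Multiplying by 1, -1, [Ci] and [- Ci] turns the one-sided bound on the real part into all four
    bounds. *)
Lemma dirichlet_bound (f w : C -> C) (D : nat -> C -> C) (S : R) :
  dirichlet f w D -> 0 < S -> (forall z, Cmod z <= 1 -> Cmod (f z) <= S) ->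
  forall z, Cmod z <= 1 -> Rabs (Re (w z)) <= 73 * S /\ Rabs (Im (w z)) <= 73 * S.
Proof.
intros h hS hf z hz.
assert (k : forall c, Cmod c = 1 -> Re (c * w z)%C <= 73 * S).
{ intros c hc; apply (dirichlet_Re_le _ _ _ S (dirichlet_scal c f w D h)); auto.
  intros x hx; rewrite Cmod_mult, hc, Rmult_1_l; auto. }
assert (i1 : Cmod Ci = 1).
{ unfold Cmod, Ci; simpl; replace (_ + _) with 1 by ring; apply sqrt_1. }
assert (k1 := k (RtoC 1) Cmod_1).
assert (k2 := k (- RtoC 1)%C Cmod_m1).
assert (k3 := k Ci i1).
assert (k4 := k (- Ci)%C ltac:(now rewrite Cmod_opp)).
destruct (w z) as [x y]; simpl in *.
split; apply Rabs_le; lra.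
Qed.
(** * Approximation by polynomials *)

(* The expectation of [F] at the position at time [n] of two independent walks started at
   [i] and [j], which step by one with probabilities [x] and [y]: Bernstein's operator. *)
Fixpoint walk (F : nat -> nat -> C) (x y : R) (n i j : nat) : C :=
  match n with
  | O => F i j
  | S n => (RtoC (x * y) * walk F x y n (S i) (S j) +
      RtoC (x * (1 - y)) * walk F x y n (S i) j +
      RtoC ((1 - x) * y) * walk F x y n i (S j) +
      RtoC ((1 - x) * (1 - y)) * walk F x y n i j)%C
  end.

(** The second moment of the walk about [(p, q)] is the squared distance of its mean from that point
    plus the variance [INR n * (x * (1 - x) + y * (1 - y))]; a quadratic bound on [F] is carried
    along by induction on the number of steps. *)
Lemma walk_bound (F : nat -> nat -> C) (x y A B p q : R) (c : C) :
  0 <= x <= 1 -> 0 <= y <= 1 ->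
  (forall i j, Cmod (F i j - c)%C <= A + B * ((INR i - p) ^ 2 + (INR j - q) ^ 2)) ->
  forall n i j, Cmod (walk F x y n i j - c)%C <=
    A + B * ((INR i + INR n * x - p) ^ 2 + (INR j + INR n * y - q) ^ 2 +
       INR n * (x * (1 - x) + y * (1 - y))).
Proof.
intros hx hy hF n; induction n as [|n IH]; intros i j.
- eapply Rle_trans; [apply hF|]; simpl; right; ring.
- cbn [walk].
  set (e1 := walk F x y n (S i) (S j)); set (e2 := walk F x y n (S i) j).
  set (e3 := walk F x y n i (S j)); set (e4 := walk F x y n i j).
  replace (_ - c)%C with (RtoC (x * y) * (e1 - c) + RtoC (x * (1 - y)) * (e2 - c) +
    RtoC ((1 - x) * y) * (e3 - c) + RtoC ((1 - x) * (1 - y)) * (e4 - c))%C.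
  2:{ rewrite !RtoC_mult, !RtoC_minus; ring. }
  assert (k1 := IH (S i) (S j)); assert (k2 := IH (S i) j).
  assert (k3 := IH i (S j)); assert (k4 := IH i j).
  fold e1 in k1; fold e2 in k2; fold e3 in k3; fold e4 in k4.
  assert (h1 : 0 <= x * y) by (apply Rmult_le_pos; lra).
  assert (h2 : 0 <= x * (1 - y)) by (apply Rmult_le_pos; lra).
  assert (h3 : 0 <= (1 - x) * y) by (apply Rmult_le_pos; lra).
  assert (h4 : 0 <= (1 - x) * (1 - y)) by (apply Rmult_le_pos; lra).
  eapply Rle_trans; [apply Cmod_triangle|].
  eapply Rle_trans; [apply Rplus_le_compat_r, Cmod_triangle|].
  eapply Rle_trans; [apply Rplus_le_compat_r, Rplus_le_compat_r, Cmod_triangle|].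
  rewrite !Cmod_mult, !Cmod_R, !Rabs_pos_eq by assumption.
  apply (Rmult_le_compat_l _ _ _ h1) in k1; apply (Rmult_le_compat_l _ _ _ h2) in k2.
  apply (Rmult_le_compat_l _ _ _ h3) in k3; apply (Rmult_le_compat_l _ _ _ h4) in k4.
  eapply Rle_trans; [repeat apply Rplus_le_compat; eassumption|].
  rewrite !S_INR; right; ring.
Qed.

Lemma poly_walk (F : nat -> nat -> C) (n i j : nat) :
  poly (fun z => walk F ((Re z + 1) / 2) ((Im z + 1) / 2) n i j).
Proof.
assert (hX : poly (fun z => RtoC ((Re z + 1) / 2))).
{ refine (poly_ext _ _ _ (poly_mult _ _ (poly_plus _ _ poly_Re (poly_const (RtoC 1)))
    (poly_const (RtoC (/ 2))))).
  intros z; unfold Rdiv; now rewrite RtoC_mult, RtoC_plus. }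
assert (hY : poly (fun z => RtoC ((Im z + 1) / 2))).
{ refine (poly_ext _ _ _ (poly_mult _ _ (poly_plus _ _ poly_Im (poly_const (RtoC 1)))
    (poly_const (RtoC (/ 2))))).
  intros z; unfold Rdiv; now rewrite RtoC_mult, RtoC_plus. }
assert (hc : forall p, poly (fun z => RtoC (p z)) -> poly (fun z => RtoC (1 - p z))).
{ intros p hp; refine (poly_ext _ _ _ (poly_plus _ _ (poly_const (RtoC 1))
    (poly_mult _ _ (poly_const (RtoC (-1))) hp))).
  intros z; rewrite <- RtoC_mult, <- RtoC_plus; f_equal; ring. }
assert (hm : forall p q, poly (fun z => RtoC (p z)) -> poly (fun z => RtoC (q z)) ->
  poly (fun z => RtoC (p z * q z))).
{ intros p q hp hq; refine (poly_ext _ _ _ (poly_mult _ _ hp hq)).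
  intros z; now rewrite RtoC_mult. }
revert i j; induction n as [|n IH]; intros i j; cbn [walk].
- apply poly_const.
- repeat apply poly_plus; apply poly_mult; auto.
Qed.

Lemma Cmod_le_abs (z : C) : Cmod z <= Rabs (Re z) + Rabs (Im z).
Proof.
replace z with (RtoC (Re z) + Ci * RtoC (Im z))%C at 1.
2:{ destruct z as [x y]; unfold RtoC, Ci, Cmult, Cplus, Re, Im; simpl; f_equal; ring. }
eapply Rle_trans; [apply Cmod_triangle|].
rewrite Cmod_mult, !Cmod_R.
replace (Cmod Ci) with 1; [lra|].
unfold Cmod, Ci; simpl; replace (_ + _) with 1 by ring; now rewrite sqrt_1.
Qed.

Lemma uniform_continuity_square (f : C -> C) (eps : R) : contC f -> 0 < eps ->
  exists d, 0 < d /\ forall x y u v, -1 <= x <= 1 -> -1 <= y <= 1 -> -1 <= u <= 1 -> -1 <= v <= 1 ->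
    Rabs (u - x) < d -> Rabs (v - y) < d -> Cmod (f (u, v) - f (x, y))%C <= eps.
Proof.
intros [c1 c2] he.
assert (he' : 0 < eps / 2) by lra.
destruct (uniform_continuity_2d (fun x y => Re (f (x, y))) (-1) 1 (-1) 1
  (fun x y _ _ => cont_2d (fun z => Re (f z)) x y c1) (mkposreal _ he')) as [[d1 p1] h1].
destruct (uniform_continuity_2d (fun x y => Im (f (x, y))) (-1) 1 (-1) 1
  (fun x y _ _ => cont_2d (fun z => Im (f z)) x y c2) (mkposreal _ he')) as [[d2 p2] h2].
simpl in *; exists (Rmin d1 d2); split; [now apply Rmin_pos|].
intros x y u v hx hy hu hv a b.
eapply Rle_trans; [apply Cmod_le_abs|].
assert (l1 := Rmin_l d1 d2); assert (l2 := Rmin_r d1 d2).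
generalize (h1 x y u v hx hy hu hv ltac:(lra) ltac:(lra)).
generalize (h2 x y u v hx hy hu hv ltac:(lra) ltac:(lra)).
change (Re (f (u, v) - f (x, y))%C) with (Re (f (u, v)) - Re (f (x, y))).
change (Im (f (u, v) - f (x, y))%C) with (Im (f (u, v)) - Im (f (x, y))).
lra.
Qed.

Lemma in_square (z : C) : Cmod z <= 1 -> -1 <= Re z <= 1 /\ -1 <= Im z <= 1.
Proof.
intros hz; generalize (Rabs_Re_le z), (Rabs_Im_le z); intros h1 h2.
split; apply Rabs_le_between; lra.
Qed.

Lemma contC_bounded (f : C -> C) : contC f ->
  exists M, 0 < M /\ forall z, Cmod z <= 1 -> Cmod (f z) <= M.
Proof.
intros hf.
destruct (disc_max (fun z => Cmod (f z))) as (a & _ & h).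
- apply cont_compC; auto using cont_Cmod.
- exists (Cmod (f a) + 1); split; [generalize (Cmod_ge_0 (f a)); lra|].
  intros z hz; generalize (h z hz); lra.
Qed.

Lemma poly_dense (f : C -> C) (eps : R) : contC f -> 0 < eps ->
  exists p, poly p /\ forall z, Cmod z <= 1 -> Cmod (p z - f z)%C <= eps.
Proof.
intros hf he.
destruct (contC_bounded f hf) as (M & hM & hb).
(* The corners of the square lie outside the disc; [g] is bounded by [M] there as well. *)
set (g := fun z => f (disc_proj z)).
assert (hg : contC g) by (apply (contC_comp f disc_proj); auto using contC_disc_proj).
assert (hgb : forall z, Cmod (g z) <= M) by (intros z; apply hb, disc_proj_le).
destruct (uniform_continuity_square g (eps / 2) hg ltac:(lra)) as (d & hd & hu).
(* This size of [n] brings the final variance term [4 * M / (d * d) / INR n] below [eps / 2]. *)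
destruct (INR_unbounded (8 * M / (d * d * eps))) as [n hn].
assert (hdd : 0 < d * d) by nra.
assert (hn0 : 0 < INR n).
{ eapply Rle_lt_trans; [|apply hn]; left; apply Rdiv_lt_0_compat; nra. }
(* The grid points of [[-1, 1]]; the cut at 1 keeps every index [i] inside the square, and acts only
   for [i] beyond [n]. *)
set (pt := fun i => Rmin 1 (2 * INR i / INR n - 1)).
assert (hpt : forall i, -1 <= pt i <= 1).
{ intros i; unfold pt; split; [|apply Rmin_l].
  apply Rmin_glb; [lra|].
  assert (0 <= 2 * INR i / INR n); [|lra].
  apply Rmult_le_pos; [generalize (pos_INR i); lra|left; now apply Rinv_0_lt_compat]. }
set (F := fun i j => g (pt i, pt j)).
exists (fun z => walk F ((Re z + 1) / 2) ((Im z + 1) / 2) n 0 0); split; [apply poly_walk|].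
intros z hz; destruct (in_square z hz) as [hx hy].
destruct z as [x y]; simpl in hx, hy; cbn [Re Im fst snd].
replace (f (x, y)) with (g (x, y)) by (unfold g; now rewrite disc_proj_id).
set (B := 2 * M / (d * d) * (4 / (INR n * INR n))).
assert (hB : 0 < B).
{ apply Rmult_lt_0_compat; apply Rdiv_lt_0_compat; nra. }
assert (hdist : forall i x, x <= 1 ->
  Rabs (pt i - x) ^ 2 <= 4 / (INR n * INR n) * (INR i - INR n * ((x + 1) / 2)) ^ 2).
{ intros i u hu1; rewrite pow2_abs.
  replace (_ * _ ^ 2) with ((2 * INR i / INR n - 1 - u) ^ 2) by (field; now apply Rgt_not_eq).
  unfold pt; apply Rmin_case_strong; intros h; [|lra].
  apply pow_incr; lra. }
eapply Rle_trans; [apply (walk_bound F _ _ (eps / 2) B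
  (INR n * ((x + 1) / 2)) (INR n * ((y + 1) / 2))); try lra|].
{ intros i j; unfold F.
  (* Chebyshev's alternative: either both coordinates are within [d] and uniform continuity applies,
     or [2 * M] is at most [2 * M / (d * d)] times the squared distance. The factor
     [4 / (INR n * INR n)] in [B] converts grid indices to distances. *)
  destruct (Rlt_le_dec (Rabs (pt i - x)) d) as [l1|l1];
    [destruct (Rlt_le_dec (Rabs (pt j - y)) d) as [l2|l2]|].
  1:{ apply Rle_trans with (eps / 2); [now apply hu|].
    rewrite <- Rplus_0_r at 1; apply Rplus_le_compat_l, Rmult_le_pos; [lra|].
    apply Rplus_le_le_0_compat; apply pow2_ge_0. }
  all: apply Rle_trans with (2 * M); [unfold Cminus; eapply Rle_trans;
    [apply Cmod_triangle|rewrite Cmod_opp; generalize (hgb (pt i, pt j)), (hgb (x, y)); lra]|].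
  all: generalize (hdist i x ltac:(lra)), (hdist j y ltac:(lra)); intros k1 k2.
  all: assert (k0 : d * d <= Rabs (pt i - x) ^ 2 + Rabs (pt j - y) ^ 2) by
    (generalize (Rabs_pos (pt i - x)), (Rabs_pos (pt j - y)); nra).
  all: set (X := (INR i - INR n * ((x + 1) / 2)) ^ 2) in *;
    set (Y := (INR j - INR n * ((y + 1) / 2)) ^ 2) in *.
  all: assert (k3 : d * d <= 4 / (INR n * INR n) * (X + Y)) by lra.
  all: assert (k4 : 2 * M / (d * d) * (d * d) <= 2 * M / (d * d) * (4 / (INR n * INR n) * (X + Y)))
    by (apply Rmult_le_compat_l; [left; apply Rdiv_lt_0_compat; lra|exact k3]).
  all: replace (2 * M / (d * d) * (d * d)) with (2 * M) in k4 by (field; now apply Rgt_not_eq).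
  all: replace (2 * M / (d * d) * (4 / (INR n * INR n) * (X + Y))) with (B * (X + Y)) in k4
    by (unfold B; ring).
  all: lra. }
(* Started at the origin, the walk has its mean exactly at the reference point; only the variance
   remains, at most [INR n / 2]. *)
- replace (INR 0 + _ - _) with 0 by (simpl; ring).
  replace (INR 0 + _ - _) with 0 by (simpl; ring).
  set (q := (x + 1) / 2 * (1 - (x + 1) / 2) + (y + 1) / 2 * (1 - (y + 1) / 2)).
  assert (hq : q <= / 2) by (unfold q; nra).
  assert (k : B * (INR n * q) <= eps / 2); [|simpl; lra].
  apply Rle_trans with (B * (INR n * / 2)).
  + apply Rmult_le_compat_l; [lra|]; apply Rmult_le_compat_l; lra.
  + unfold B; replace (_ * _) with (4 * M / (d * d) / INR n) by (field; split; now apply Rgt_not_eq).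
    apply Rle_div_l; auto.
    apply Rlt_div_l in hn; [|nra].
    apply Rle_div_l; auto; lra.
Qed.
(** * Passage to the limit *)

(** Subtracting [eta * defect] raises the means by [eta * (r * r)] relative to the center, more than
    the error [eta / 2 * (r * r)] on small circles. The maximum principle applies, and then [eta]
    tends to 0. *)
Lemma blaschke_privalov (V : C -> R) : cont V ->
  (forall z, Cmod z = 1 -> V z = 0) ->
  (forall a, Cmod a < 1 -> forall eps, 0 < eps -> exists r0, 0 < r0 /\ forall r, 0 < r < r0 ->
     V a - eps * (r * r) <= avg (fun t => V (a + r * cis t)%C)) ->
  forall z, Cmod z <= 1 -> V z <= 0.
Proof.
intros hV hb hi z hz.
apply le_epsilon; intros eta heta.
assert (hd : 0 <= defect z <= 1).
{ rewrite defect_eq; generalize (Cmod_ge_0 z); nra. }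
assert (hc : cont (fun z => eta * defect z)).
{ apply cont_mult; [apply cont_const|apply cont_defect]. }
assert (h : V z - eta * defect z <= 0); [|nra].
apply (max_principle (fun z => V z - eta * defect z)); auto.
- now apply cont_minus.
- intros x hx; rewrite (hb x hx), defect_eq, hx; lra.
- intros a ha _.
  destruct (hi a ha (eta / 2) ltac:(lra)) as (r0 & hr0 & hr).
  set (r := Rmin (r0 / 2) (1 - Cmod a)).
  assert (l1 := Rmin_l (r0 / 2) (1 - Cmod a)); assert (l2 := Rmin_r (r0 / 2) (1 - Cmod a)).
  assert (l3 : 0 < r) by (apply Rmin_glb_lt; lra).
  fold r in l1, l2; exists r; split; [lra|].
  rewrite avg_minus by (intros t;
    first [exact (cont_circle _ a r t hV)|exact (cont_circle _ a r t hc)]).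
  rewrite avg_scal by (intros t; exact (cont_circle _ a r t cont_defect)).
  rewrite avg_defect.
  assert (l4 : 0 < eta * (r * r)) by (repeat apply Rmult_lt_0_compat; lra).
  generalize (hr r ltac:(lra)); lra.
Qed.

Lemma uniform_limit (V : nat -> C -> R) (e : nat -> R) :
  (forall n, cont (V n)) -> is_lim_seq e 0 ->
  (forall n m z, Rabs (V n z - V m z) <= e n + e m) ->
  exists W, cont W /\ forall n z, Rabs (V n z - W z) <= e n.
Proof.
intros hV he h.
assert (hsmall : forall eps, 0 < eps -> exists N, forall n, (N <= n)%nat -> e n < eps).
{ intros eps h0; apply is_lim_seq_spec in he.
  destruct (he (mkposreal _ h0)) as [N hN]; exists N; intros n hn.
  generalize (hN n hn); simpl; intros k; apply Rabs_def2 in k; lra. }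
assert (hex : forall z, exists l : R, is_lim_seq (fun n => V n z) l).
{ intros z; apply ex_lim_seq_cauchy_corr; intros eps.
  destruct (hsmall (eps / 2)) as [N hN]; [destruct eps; simpl; lra|].
  exists N; intros n m hn hm; generalize (h n m z), (hN n hn), (hN m hm); lra. }
exists (fun z => proj1_sig (constructive_indefinite_description _ (hex z))).
assert (hW : forall n z,
  Rabs (V n z - proj1_sig (constructive_indefinite_description _ (hex z))) <= e n).
{ intros n z; destruct (constructive_indefinite_description _ (hex z)) as [l hl]; simpl.
  apply (is_lim_seq_le (fun m => Rabs (V n z - V m z)) (fun m => e n + e m)
    (Rabs (V n z - l)) (e n)).
  - intros m; apply h.
  - apply (is_lim_seq_abs _ (V n z - l)).
    apply is_lim_seq_minus'; [apply is_lim_seq_const|exact hl].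
  - replace (e n) with (e n + 0) at 1 by ring.
    apply is_lim_seq_plus'; [apply is_lim_seq_const|exact he]. }
split; auto.
set (W := fun z => proj1_sig (constructive_indefinite_description _ (hex z))) in *.
change (forall n z, Rabs (V n z - W z) <= e n) in hW.
intros z; apply filterlim_locally; intros eps.
destruct (hsmall (eps / 3)) as [N hN]; [destruct eps; simpl; lra|].
assert (h3 : 0 < eps / 3) by (destruct eps; simpl; lra).
generalize (proj1 (filterlim_locally _ _) (hV N z) (mkposreal _ h3)).
apply filter_imp; intros y hy.
change (Rabs (V N y - V N z) < eps / 3) in hy.
change (Rabs (W y - W z) < eps).
assert (k1 := hW N y); assert (k2 := hW N z); assert (k3 := hN N (le_n _)).
apply Rabs_le_between in k1; apply Rabs_le_between in k2; apply Rabs_def2 in hy.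
apply Rabs_def1; lra.
Qed.

Definition gap (n : nat) : R := / (INR n + 1).

Lemma gap_pos (n : nat) : 0 < gap n.
Proof. apply Rinv_0_lt_compat; generalize (pos_INR n); lra. Qed.

Lemma gap_lim : is_lim_seq gap 0.
Proof.
apply (is_lim_seq_ext (fun n => / INR (S n))).
{ intros n; now rewrite S_INR. }
apply (is_lim_seq_incr_1 (fun n => / INR n)).
replace (Finite 0) with (Rbar_inv p_infty) by reflexivity.
apply is_lim_seq_inv; [apply is_lim_seq_INR|discriminate].
Qed.

Definition approximates (f : C -> C) (p w : nat -> C -> C) (D : nat -> nat -> C -> C) : Prop :=
  forall n, dirichlet (p n) (w n) (D n) /\
    forall z, Cmod z <= 1 -> Cmod (p n z - f z)%C <= gap n.

Lemma approximates_exist (f : C -> C) : contC f -> exists p w D, approximates f p w D.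
Proof.
intros hf.
assert (h : forall n, exists q : (C -> C) * (C -> C) * (nat -> C -> C),
  dirichlet (fst (fst q)) (snd (fst q)) (snd q) /\
  forall z, Cmod z <= 1 -> Cmod (fst (fst q) z - f z)%C <= gap n).
{ intros n; destruct (poly_dense f (gap n) hf (gap_pos n)) as (p & hp & hpf).
  destruct (poly_dirichlet p hp) as (w & D & hw).
  now exists (p, w, D). }
set (q := fun n => proj1_sig (constructive_indefinite_description _ (h n))).
exists (fun n => fst (fst (q n))), (fun n => snd (fst (q n))), (fun n => snd (q n)).
intros n; unfold q; apply (proj2_sig (constructive_indefinite_description _ (h n))).
Qed.

Lemma approximates_scal (c : C) (f : C -> C) (p w : nat -> C -> C) (D : nat -> nat -> C -> C) :
  Cmod c = 1 -> approximates f p w D ->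
  approximates (fun z => c * f z)%C (fun n z => c * p n z)%C (fun n z => c * w n z)%C
    (fun n m z => c * D n m z)%C.
Proof.
intros hc h n; destruct (h n) as [h1 h2]; split; [now apply dirichlet_scal|].
intros z hz; replace (c * p n z - c * f z)%C with (c * (p n z - f z))%C by ring.
rewrite Cmod_mult, hc, Rmult_1_l; auto.
Qed.

(* Only real parts are constrained: imaginary parts are covered by the condition on [- Ci * f]. *)
Definition small_means (f : C -> C) : Prop :=
  forall a, Cmod a < 1 -> forall eps, 0 < eps -> exists r0, 0 < r0 /\ forall r, 0 < r < r0 ->
    Rabs (avg (fun t => Re (f (a + r * cis t) * cis t)%C)) <= eps * r.

(** By linearity [w n - w m] solves the Dirichlet problem for [p n - p m], whose sup norm is at most
    [gap n + gap m]. *)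
Lemma approximates_Re_gap (f : C -> C) (p w : nat -> C -> C) (D : nat -> nat -> C -> C) :
  approximates f p w D -> forall n m z, Cmod z <= 1 ->
  Rabs (Re (w n z) - Re (w m z)) <= 73 * gap n + 73 * gap m.
Proof.
intros h n m z hz; destruct (h n) as [h1 h2], (h m) as [k1 k2].
destruct (dirichlet_minus _ _ _ _ _ _ h1 k1) as [H hH].
destruct (dirichlet_bound _ _ _ (gap n + gap m) hH) with (z := z) as [b _]; auto.
- generalize (gap_pos n), (gap_pos m); lra.
- intros x hx; replace (p n x - p m x)%C with ((p n x - f x) + - (p m x - f x))%C by ring.
  eapply Rle_trans; [apply Cmod_triangle|rewrite Cmod_opp].
  generalize (h2 x hx), (k2 x hx); lra.
- replace (Re (w n z) - Re (w m z)) with (Re (w n z + RtoC (-1) * w m z)%C); [lra|].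
  rewrite Re_plus, re_scal_l; ring.
Qed.

Lemma approximates_increment (f : C -> C) (p w : nat -> C -> C) (D : nat -> nat -> C -> C)
    (a : C) (r eps : R) (n : nat) :
  approximates f p w D -> contC f -> 0 < r <= 1 - Cmod a ->
  (forall s, 0 < s < r -> Rabs (avg (fun t => Re (f (a + s * cis t) * cis t)%C)) <= eps) ->
  Rabs (avg (fun t => Re (w n (a + r * cis t)%C)) - Re (w n a)) <= 2 * (eps + gap n) * r.
Proof.
intros h hf hr hs; destruct (h n) as [h1 h2].
destruct (h1) as (cp & hD & [w2 hw] & _).
apply (avg_increment_le _ _ _ a r (eps + gap n) hw); [lra|].
intros s hsr; rewrite (dirichlet_avg_cis _ _ _ a s h1) by lra.
replace (avg _) with (avg (fun t => Re (f (a + s * cis t) * cis t)%C) +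
  avg (fun t => Re ((p n (a + s * cis t) + - f (a + s * cis t)) * cis t)%C)).
2:{ rewrite avg_Re_cis_minus by assumption; ring. }
eapply Rle_trans; [apply Rabs_triang|]; apply Rplus_le_compat; [now apply hs|].
apply avg_abs.
- apply (avg_circle_Re_cis (fun z => p n z + - f z)%C).
  apply contC_plus; auto.
  apply (contC_ext (fun z => RtoC (-1) * f z)%C); [intros; ring|].
  apply contC_mult; auto; apply contC_const.
- intros t; eapply Rle_trans; [apply Rabs_Re_cis_le|apply h2].
  generalize (Cmod_circle_le a s t); lra.
Qed.

(** The bound is the distance from [Re (w n)] to its uniform limit [V]: both [V] and [- V] satisfy
    the hypotheses of [blaschke_privalov], so [V] is 0 on the disc. *)
Lemma approximates_Re_small (f : C -> C) (p w : nat -> C -> C) (D : nat -> nat -> C -> C) :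
  approximates f p w D -> contC f -> small_means f ->
  forall n z, Cmod z <= 1 -> Rabs (Re (w n z)) <= 73 * gap n.
Proof.
intros h hf hs.
assert (hcw : forall n, contC (w n)).
{ intros n; destruct (h n) as [(_ & _ & [w2 (_ & _ & c & _)] & _) _]; exact c. }
assert (hlim : is_lim_seq (fun n => 73 * gap n) 0).
{ replace (Finite 0) with (Rbar_mult 73 0) by (simpl; f_equal; ring).
  apply is_lim_seq_scal_l, gap_lim. }
destruct (uniform_limit (fun n z => Re (w n (disc_proj z))) (fun n => 73 * gap n))
  as (V & cV & hV); auto.
{ intros n; apply (cont_compC (fun z => Re (w n z))); [apply hcw|apply contC_disc_proj]. }
{ intros n m z; apply (approximates_Re_gap f p w D h), disc_proj_le. }
assert (hV' : forall n z, Cmod z <= 1 -> Rabs (Re (w n z) - V z) <= 73 * gap n).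
{ intros n z hz; rewrite <- (disc_proj_id z hz) at 1; apply hV. }
assert (hb : forall z, Cmod z = 1 -> V z = 0).
{ intros z hz; apply Rabs_eq_0, Rle_antisym; [|apply Rabs_pos].
  apply (is_lim_seq_le (fun _ => Rabs (V z)) (fun n => 73 * gap n) (Rabs (V z)) 0); auto.
  - intros n; generalize (hV' n z (or_intror hz)).
    destruct (h n) as [(_ & _ & _ & bw) _]; rewrite (bw z hz), <- Rabs_Ropp; simpl.
    now replace (- (0 - V z)) with (V z) by ring.
  - apply is_lim_seq_const. }
assert (hi : forall a, Cmod a < 1 -> forall eps, 0 < eps -> exists r0, 0 < r0 /\
   forall r, 0 < r < r0 -> Rabs (avg (fun t => V (a + r * cis t)%C) - V a) <= eps * (r * r)).
{ intros a ha eps he.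
  destruct (hs a ha (eps / 2) ltac:(lra)) as (r0 & hr0 & hr).
  exists (Rmin r0 (1 - Cmod a)); split; [apply Rmin_glb_lt; lra|].
  intros r hrr.
  assert (l1 := Rmin_l r0 (1 - Cmod a)); assert (l2 := Rmin_r r0 (1 - Cmod a)).
  assert (hdisc : forall t, Cmod (a + r * cis t)%C <= 1).
  { intros t; generalize (Cmod_circle_le a r t); lra. }
  (* The radius stays fixed while [n] tends to infinity. The terms in [gap n] come from
     [approximates_increment] ([2 * r]) and from replacing [w n] by [V] at the center and on the
     circle ([146 = 2 * 73]). *)
  apply (is_lim_seq_le (fun _ => Rabs (avg (fun t => V (a + r * cis t)%C) - V a))
    (fun n => eps * (r * r) + (2 * r + 146) * gap n)
    (Rabs (avg (fun t => V (a + r * cis t)%C) - V a)) (eps * (r * r))).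
  - intros n.
    assert (k1 := approximates_increment f p w D a r (eps / 2 * r) n h hf ltac:(lra)
      (fun s hs => Rle_trans _ _ _ (hr s ltac:(lra))
        (Rmult_le_compat_l (eps / 2) s r ltac:(lra) ltac:(lra)))).
    assert (k2 := hV' n a ltac:(lra)).
    assert (k3 : Rabs (avg (fun t => Re (w n (a + r * cis t)%C)) -
      avg (fun t => V (a + r * cis t)%C)) <= 73 * gap n).
    { assert (d1 : continuous1 (fun t => Re (w n (a + r * cis t)%C))) by now apply contC_circle.
      assert (d2 : continuous1 (fun t => V (a + r * cis t)%C)) by (intros t; now apply cont_circle).
      rewrite <- avg_minus by assumption; apply avg_abs; auto.
      intros t; apply (continuous_minus (V := R_NormedModule)); auto. }
    apply Rabs_le_between in k1; apply Rabs_le_between in k2; apply Rabs_le_between in k3.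
    apply Rabs_le; lra.
  - apply is_lim_seq_const.
  - replace (eps * (r * r)) with (eps * (r * r) + (2 * r + 146) * 0) at 1 by ring.
    apply is_lim_seq_plus'; [apply is_lim_seq_const|].
    apply (is_lim_seq_scal_l gap (2 * r + 146) 0), gap_lim. }
assert (V0 : forall z, Cmod z <= 1 -> V z = 0).
{ intros z hz; apply Rle_antisym.
  - apply blaschke_privalov; auto.
    intros a ha eps he; destruct (hi a ha eps he) as (r0 & hr0 & hr).
    exists r0; split; auto; intros r hrr; generalize (hr r hrr); intros k.
    apply Rabs_le_between in k; lra.
  - assert (- V z <= 0); [|lra].
    assert (cV' : cont (fun z => - V z)).
    { intros x; apply (continuous_opp (V := R_NormedModule)); auto. }
    apply (blaschke_privalov (fun z => - V z)); auto.
    + intros x hx; rewrite hb; auto; ring.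
    + intros a ha eps he; destruct (hi a ha eps he) as (r0 & hr0 & hr).
      exists r0; split; auto; intros r hrr; generalize (hr r hrr); intros k.
      rewrite (avg_ext _ (fun t => (-1) * V (a + r * cis t)%C)) by (intros; ring).
      rewrite avg_scal by (intros t; now apply cont_circle).
      apply Rabs_le_between in k; lra. }
intros n z hz; generalize (hV' n z hz); rewrite (V0 z hz); now rewrite Rminus_0_r.
Qed.

Lemma Re_Copp_Ci (z : C) : Re (- Ci * z)%C = Im z.
Proof. unfold Ci, Re, Im; simpl; ring. Qed.

Lemma Cmod_opp_Ci : Cmod (- Ci)%C = 1.
Proof.
rewrite Cmod_opp; unfold Cmod, Ci; simpl; replace (_ + _) with 1 by ring; apply sqrt_1.
Qed.

Lemma Rabs_Re_conj_cis_le (z : C) (t : R) : Rabs (Re (z * Cconj (cis t))%C) <= Cmod z.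
Proof. eapply Rle_trans; [apply Rabs_Re_le|]; rewrite Cmod_mult, Cmod_conj, Cmod_cis; lra. Qed.

(* Integrating the radial derivative of the mean of [w conj (z - a)] recovers [f - D 1] from [w]. *)
Lemma dirichlet_recover (f w : C -> C) (D : nat -> C -> C) (a y : C) (r e B : R) :
  dirichlet f w D -> 0 < r ->
  (forall s t, 0 <= s <= r -> Cmod (f (a + s * cis t) - y)%C <= e) ->
  (forall t, Cmod (w (a + r * cis t)%C) <= B) ->
  Rabs (Re (D 1%nat a) - Re y) <= 2 * e + B / r.
Proof.
intros (cf & hD & [w2 hw] & _) hr hf hB.
(* If [f] were equal to [y] throughout, [chi s] would be exactly [m * (s * s)], since [D 1] has its
   central value as mean. Comparing with this parabola isolates [m]. *)
set (m := Re y - Re (D 1%nat a)).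
set (chi := fun s => s * avg (fun t => Re (w (a + s * cis t) * Cconj (cis t))%C)).
set (dchi := fun s => 2 * s * avg (fun t => Re (f (a + s * cis t) + - D 1%nat (a + s * cis t))%C)).
assert (hchi : forall s, 0 < s -> is_derive chi s (dchi s)).
{ intros s hs; apply (is_derive_avg_conj _ _ _ a s hw); lra. }
assert (k : Rabs ((chi r - m * (r * r)) - (chi 0 - m * (0 * 0))) <= (2 * r * e) * r).
{ apply (increment_le (fun s => chi s - m * (s * s)) (fun s => dchi s - m * (s + s))); [lra| | |].
  - intros s hs; apply (is_derive_minus (V := R_NormedModule)); [now apply hchi|].
    auto_derive; auto; ring.
  - intros s hs; apply continuity_pt_minus.
    + exact (continuity_avg_conj _ _ _ a s hw).
    + apply derivable_continuous_pt, ex_derive_Reals_0; auto_derive; auto.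
  - intros s hs; unfold dchi.
    assert (cD : contC (D 1%nat)) by apply (hD 1%nat).
    rewrite (avg_ext _ (fun t => Re (f (a + s * cis t)%C) - Re (D 1%nat (a + s * cis t)%C)))
      by reflexivity.
    rewrite avg_minus by now apply contC_circle.
    rewrite (avg_holomorphic _ _ a s (hD 1%nat)) by lra.
    replace (_ - _) with (2 * s * (avg (fun t => Re (f (a + s * cis t)%C)) - Re y))
      by (unfold m; ring).
    rewrite Rabs_mult, (Rabs_pos_eq (2 * s)) by lra.
    assert (k : Rabs (avg (fun t => Re (f (a + s * cis t)%C)) - Re y) <= e).
    { rewrite <- (avg_const (Re y)), <- avg_minus.
      - apply avg_abs.
        + intros t; apply (continuous_minus (V := R_NormedModule));
            [now apply contC_circle|apply continuous_const].
        + intros t; eapply Rle_trans; [|apply (hf s t); lra].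
          apply (Rabs_Re_le (f (a + s * cis t) - y)%C).
      - now apply contC_circle.
      - intros t; apply continuous_const. }
    apply Rle_trans with (2 * s * e); [apply Rmult_le_compat_l; lra|].
    generalize (Rle_trans _ _ _ (Rabs_pos _) k); nra. }
assert (k2 : Rabs (avg (fun t => Re (w (a + r * cis t) * Cconj (cis t))%C)) <= B).
{ apply avg_abs; [apply avg_circle_Re_conj_cis, hw|].
  intros t; eapply Rle_trans; [apply Rabs_Re_conj_cis_le|apply hB]. }
unfold chi in k; rewrite Rmult_0_l in k.
set (A := avg (fun t => Re (w (a + r * cis t) * Cconj (cis t))%C)) in *.
apply Rabs_le_between in k; apply Rabs_le_between in k2.
replace (Re (D 1%nat a) - Re y) with (- m) by (unfold m; ring).
assert (e1 : B / r * r = B) by (field; now apply Rgt_not_eq).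
assert (e2 : B / r * (r * r) = B * r) by (rewrite <- Rmult_assoc, e1; ring).
apply Rabs_le; split; apply (Rmult_le_reg_r (r * r)); nra.
Qed.

Lemma holomorphic_approximation (f : C -> C) : contC f -> small_means f ->
  small_means (fun z => - Ci * f z)%C -> forall eps, 0 < eps ->
  exists D, (forall n, is_wirtinger (D n) (D (S n)) zeroC) /\
    forall a, Cmod a <= 1 / 2 -> Cmod (D 1%nat a - f a)%C <= eps.
Proof.
intros hf hs hs' eps heps.
destruct (approximates_exist f hf) as (p & w & D & h).
assert (hf' : contC (fun z => - Ci * f z)%C) by (apply contC_mult; auto; apply contC_const).
assert (h' := approximates_scal (- Ci)%C _ _ _ _ Cmod_opp_Ci h).
assert (b1 := approximates_Re_small _ _ _ _ h hf hs).
assert (b2 := approximates_Re_small _ _ _ _ h' hf' hs').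
destruct (uniform_continuity_square f (eps / 16) hf ltac:(lra)) as (d & hd & hu).
(* The radius depends only on the modulus of continuity and is fixed before [n], so that the
   division by [r] in [dirichlet_recover] is harmless. *)
set (r := Rmin (d / 2) (1 / 2)).
assert (l1 := Rmin_l (d / 2) (1 / 2)); assert (l2 := Rmin_r (d / 2) (1 / 2)); fold r in l1, l2.
assert (hr : 0 < r) by (apply Rmin_glb_lt; lra).
(* Real and imaginary parts get [eps / 2] each: [2 * (eps / 8)] from the oscillation and
   approximation of [f], and [146 * eta / r <= eps / 4] from the size of [w n], where 146 adds the
   bounds 73 for its two components. *)
set (eta := Rmin (eps / 16) (eps * r / (4 * 146))).
assert (heta : 0 < eta) by (apply Rmin_glb_lt; [lra|apply Rdiv_lt_0_compat; nra]).
assert (m1 := Rmin_l (eps / 16) (eps * r / (4 * 146))).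
assert (m2 := Rmin_r (eps / 16) (eps * r / (4 * 146))); fold eta in m1, m2.
assert (hn : exists n, gap n < eta).
{ generalize gap_lim; intros k; apply is_lim_seq_spec in k.
  destruct (k (mkposreal _ heta)) as [N hN]; exists N.
  generalize (hN N (le_n _)); simpl; intros k'; apply Rabs_def2 in k'; lra. }
destruct hn as [n hn].
exists (D n); destruct (h n) as [hdir hpf]; split; [apply hdir|].
intros a ha.
assert (hdisc : forall s t, 0 <= s <= r -> Cmod (a + s * cis t)%C <= 1).
{ intros s t hst; generalize (Cmod_circle_le a s t); lra. }
assert (hfa : forall s t, 0 <= s <= r -> Cmod (p n (a + s * cis t) - f a)%C <= eps / 8).
{ intros s t hst.
  replace (p n (a + s * cis t) - f a)%C with ((p n (a + s * cis t) - f (a + s * cis t)) +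
    (f (a + s * cis t) - f a))%C by ring.
  eapply Rle_trans; [apply Cmod_triangle|].
  generalize (hpf _ (hdisc s t hst)); intros k1.
  assert (k2 : Cmod (f (a + s * cis t) - f a)%C <= eps / 16); [|lra].
  assert (q1 := in_square a ltac:(lra)); assert (q2 := in_square _ (hdisc s t hst)).
  assert (q3 : Cmod ((a + s * cis t) - a)%C <= s).
  { replace ((a + s * cis t) - a)%C with (RtoC s * cis t)%C by ring.
    rewrite Cmod_mult, Cmod_R, Cmod_cis, Rabs_pos_eq; lra. }
  assert (q4 := Rabs_Re_le ((a + s * cis t) - a)%C).
  assert (q5 := Rabs_Im_le ((a + s * cis t) - a)%C).
  change (Re ((a + s * cis t) - a)%C) with (Re (a + s * cis t)%C - Re a) in q4.
  change (Im ((a + s * cis t) - a)%C) with (Im (a + s * cis t)%C - Im a) in q5.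
  destruct (a + s * cis t)%C as [u v], a as [x y]; cbn [Re Im fst snd] in *.
  apply hu; lra. }
assert (hwB : forall t, Cmod (w n (a + r * cis t)%C) <= 146 * eta).
{ intros t; assert (hz := hdisc r t ltac:(lra)).
  eapply Rle_trans; [apply Cmod_le_abs|].
  generalize (b1 n _ hz), (b2 n _ hz); rewrite Re_Copp_Ci; lra. }
assert (hBr : 146 * eta / r <= eps / 4).
{ apply Rle_div_l; auto; lra. }
eapply Rle_trans; [apply Cmod_le_abs|].
assert (k1 := dirichlet_recover _ _ _ a (f a) r (eps / 8) (146 * eta) hdir hr hfa hwB).
assert (k2 := dirichlet_recover _ _ _ a (- Ci * f a)%C r (eps / 8) (146 * eta)
  (dirichlet_scal (- Ci)%C _ _ _ hdir) hr).
rewrite !Re_Copp_Ci in k2.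
change (Re (D n 1%nat a - f a)%C) with (Re (D n 1%nat a) - Re (f a)).
change (Im (D n 1%nat a - f a)%C) with (Im (D n 1%nat a) - Im (f a)).
enough (Rabs (Im (D n 1%nat a) - Im (f a)) <= 2 * (eps / 8) + 146 * eta / r) by lra.
apply k2.
- intros s t hst.
  replace (- Ci * p n (a + s * cis t) - - Ci * f a)%C with
    (- Ci * (p n (a + s * cis t) - f a))%C by ring.
  rewrite Cmod_mult, Cmod_opp_Ci, Rmult_1_l; auto.
- intros t; rewrite Cmod_mult, Cmod_opp_Ci, Rmult_1_l; auto.
Qed.
(** * Differentiability of the limit *)

Lemma is_derive_curve_segment (z : C) (s : R) : is_derive_curve (fun s => RtoC s * z)%C s z.
Proof.
split.
- apply (is_derive_ext (fun s => s * Re z)); [intros; now rewrite re_scal_l|].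
  auto_derive; auto; ring.
- apply (is_derive_ext (fun s => s * Im z)); [intros; now rewrite im_scal_l|].
  auto_derive; auto; ring.
Qed.

Lemma holomorphic_increment_Re (q q1 : C -> C) (z : C) (K : R) :
  is_wirtinger q q1 zeroC -> (forall x, Cmod x <= Cmod z -> Cmod (q1 x) <= K) ->
  Rabs (Re (q z) - Re (q (RtoC 0))) <= K * Cmod z.
Proof.
intros (_ & _ & _ & h) hK.
assert (hd : forall s : R, is_derive (fun s => Re (q (RtoC s * z)%C)) s
  (Re (q1 (RtoC s * z) * z + zeroC (RtoC s * z) * Cconj z)%C)).
{ intros s; exact (proj1 (h _ _ _ (is_derive_curve_segment z s))). }
replace z with (RtoC 1 * z)%C at 1 by ring.
replace (RtoC 0) with (RtoC 0 * z)%C at 1 by ring.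
rewrite <- (Rmult_1_r (K * Cmod z)).
apply (increment_le (fun s => Re (q (RtoC s * z)%C)) _ 1 (K * Cmod z) Rle_0_1
  (fun s _ => hd s)).
- intros s _; apply continuity_pt_filterlim, (ex_derive_continuous (V := R_NormedModule)).
  eexists; apply hd.
- intros s hs; eapply Rle_trans; [apply Rabs_Re_le|].
  unfold zeroC; rewrite Cmult_0_l, Cplus_0_r, Cmod_mult.
  apply Rmult_le_compat_r; [apply Cmod_ge_0|apply hK].
  rewrite Cmod_mult, Cmod_R, Rabs_pos_eq by lra.
  generalize (Cmod_ge_0 z); nra.
Qed.

Lemma is_wirtinger_scal_holomorphic (c : C) (q q1 : C -> C) :
  is_wirtinger q q1 zeroC ->
  is_wirtinger (fun z => c * q z)%C (fun z => c * q1 z)%C zeroC.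
Proof.
intros h; generalize (is_wirtinger_scal c _ _ _ h).
apply is_wirtinger_ext; intros; unfold zeroC; ring.
Qed.

(** The factor 2 comes from estimating the two components separately, the imaginary part being the
    real part of [- Ci * q]. *)
Lemma holomorphic_increment (q q1 : C -> C) (z : C) (K : R) :
  is_wirtinger q q1 zeroC -> (forall x, Cmod x <= Cmod z -> Cmod (q1 x) <= K) ->
  Cmod (q z - q (RtoC 0))%C <= 2 * K * Cmod z.
Proof.
intros h hK; eapply Rle_trans; [apply Cmod_le_abs|].
assert (k1 := holomorphic_increment_Re _ _ z K h hK).
assert (k2 := holomorphic_increment_Re _ _ z K (is_wirtinger_scal_holomorphic (- Ci)%C _ _ h)).
cbv beta in k2; rewrite !Re_Copp_Ci in k2.
change (Re (q z - q (RtoC 0))%C) with (Re (q z) - Re (q (RtoC 0))).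
change (Im (q z - q (RtoC 0))%C) with (Im (q z) - Im (q (RtoC 0))).
enough (Rabs (Im (q z) - Im (q (RtoC 0))) <= K * Cmod z) by lra.
apply k2; intros x hx; rewrite Cmod_mult, Cmod_opp_Ci, Rmult_1_l; auto.
Qed.

(** Cauchy's formula for the derivative at the center. By the mean value property of [q1], the
    function [chi] has derivative [2 * s * Re (q1 a)], hence equals [s * s * Re (q1 a)]. *)
Lemma cauchy_formula (q q1 q2 : C -> C) (a : C) (r : R) :
  is_wirtinger q q1 zeroC -> is_wirtinger q1 q2 zeroC -> 0 < r ->
  avg (fun t => Re (q (a + r * cis t) * Cconj (cis t))%C) = r * Re (q1 a).
Proof.
intros h h1 hr.
set (chi := fun s => s * avg (fun t => Re (q (a + s * cis t) * Cconj (cis t))%C)).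
assert (k : Rabs ((chi r - Re (q1 a) * (r * r)) - (chi 0 - Re (q1 a) * (0 * 0))) <= 0 * r).
{ apply (increment_le (fun s => chi s - Re (q1 a) * (s * s))
    (fun s => 2 * s * avg (fun t => Re (q1 (a + s * cis t)%C)) - Re (q1 a) * (s + s))); [lra| | |].
  - intros s hs; apply (is_derive_minus (V := R_NormedModule)).
    + apply (is_derive_avg_conj _ _ _ a s h); lra.
    + auto_derive; auto; ring.
  - intros s hs; apply continuity_pt_minus.
    + exact (continuity_avg_conj _ _ _ a s h).
    + apply derivable_continuous_pt, ex_derive_Reals_0; auto_derive; auto.
  - intros s hs; rewrite (avg_holomorphic _ _ a s h1) by lra.
    replace (_ - _) with 0 by ring; rewrite Rabs_R0; lra. }
rewrite Rmult_0_l in k; unfold chi in k; rewrite Rmult_0_l in k.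
apply Rabs_le_between in k; apply (Rmult_eq_reg_l r); nra.
Qed.

Lemma cauchy_estimate (q q1 q2 : C -> C) (a : C) (r B : R) :
  is_wirtinger q q1 zeroC -> is_wirtinger q1 q2 zeroC -> 0 < r ->
  (forall z, Cmod z <= Cmod a + r -> Cmod (q z) <= B) -> r * Cmod (q1 a) <= 2 * B.
Proof.
intros h h1 hr hB.
assert (k : forall c, Cmod c = 1 -> Rabs (r * Re (c * q1 a)%C) <= B).
{ intros c hc.
  rewrite <- (cauchy_formula _ _ _ a r (is_wirtinger_scal_holomorphic c _ _ h)
    (is_wirtinger_scal_holomorphic c _ _ h1) hr).
  apply avg_abs.
  - apply (avg_circle_Re_conj_cis (fun z => c * q z)%C), (is_wirtinger_scal_holomorphic c _ _ h).
  - intros t; eapply Rle_trans; [apply Rabs_Re_conj_cis_le|].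
    rewrite Cmod_mult, hc, Rmult_1_l; apply hB, Cmod_circle_le; lra. }
assert (k1 := k (RtoC 1) Cmod_1); rewrite Cmult_1_l in k1.
assert (k2 := k (- Ci)%C Cmod_opp_Ci); rewrite Re_Copp_Ci in k2.
rewrite Rabs_mult, Rabs_pos_eq in k1, k2 by lra.
generalize (Rmult_le_compat_l r _ _ ltac:(lra) (Cmod_le_abs (q1 a))); lra.
Qed.

Lemma holomorphic_taylor (D : nat -> C -> C) (B : R) (z : C) :
  (forall n, is_wirtinger (D n) (D (S n)) zeroC) ->
  (forall x, Cmod x <= 1 / 2 -> Cmod (D 1%nat x) <= B) -> Cmod z <= 1 / 8 ->
  Cmod (D 1%nat z - D 1%nat (RtoC 0) - D 2%nat (RtoC 0) * z)%C <= 512 * B * (Cmod z * Cmod z).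
Proof.
intros hD hB hz.
(* The disc shrinks from radius 1/2 to 1/4 to 1/8, each Cauchy estimate costing a factor [2 / r]: 8,
   then 16. The two integrations at the end cost 2 each, whence [512 = 4 * 128]. *)
assert (h2 : forall x, Cmod x <= 1 / 4 -> Cmod (D 2%nat x) <= 8 * B).
{ intros x hx; generalize (cauchy_estimate _ _ _ x (1 / 4) B (hD 1%nat) (hD 2%nat) ltac:(lra)
    (fun y hy => hB y ltac:(lra))); lra. }
assert (h3 : forall x, Cmod x <= 1 / 8 -> Cmod (D 3%nat x) <= 128 * B).
{ intros x hx; generalize (cauchy_estimate _ _ _ x (1 / 8) (8 * B) (hD 2%nat) (hD 3%nat) ltac:(lra)
    (fun y hy => h2 y ltac:(lra))); lra. }
assert (hB0 : 0 <= B).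
{ eapply Rle_trans; [apply Cmod_ge_0|apply (hB (RtoC 0))]; rewrite Cmod_0; lra. }
assert (hq : is_wirtinger (fun x => D 1%nat x + (- D 2%nat (RtoC 0)) * x)%C
  (fun x => D 2%nat x - D 2%nat (RtoC 0))%C zeroC).
{ generalize (is_wirtinger_plus _ _ _ _ _ _ (hD 1%nat)
    (is_wirtinger_scal (- D 2%nat (RtoC 0))%C _ _ _ is_wirtinger_id)).
  apply is_wirtinger_ext; intros; unfold zeroC; ring. }
replace (_ - _)%C with ((D 1%nat z + (- D 2%nat (RtoC 0)) * z) -
  (D 1%nat (RtoC 0) + (- D 2%nat (RtoC 0)) * RtoC 0))%C by ring.
eapply Rle_trans; [apply (holomorphic_increment _ _ z (256 * B * Cmod z) hq)|right; ring].
intros x hx.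
eapply Rle_trans; [apply (holomorphic_increment _ _ x (128 * B) (hD 2%nat))|].
- intros y hy; apply h3; lra.
- generalize (Cmod_ge_0 x); nra.
Qed.

Lemma quadratic_approximation (f : C -> C) : contC f -> small_means f ->
  small_means (fun z => - Ci * f z)%C ->
  exists k B, 0 < B /\ forall z, Cmod z <= 1 / 8 ->
    Cmod (f z - f (RtoC 0) - k * z)%C <= B * (Cmod z * Cmod z).
Proof.
intros hf hs hs'.
destruct (contC_bounded f hf) as (M & hM & hfM).
(* The approximants [D] depend on [eps], but the derivative must not. It is therefore read off from
   [f] itself, by Cauchy's formula on the circle of radius 1/4, and 4 is the inverse radius. *)
set (A := fun c => 4 * avg (fun t => Re (c * f (RtoC 0 + RtoC (1 / 4) * cis t) * Cconj (cis t))%C)).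
exists (A (RtoC 1), A (- Ci)%C), (512 * (M + 1)); split; [lra|].
intros z hz; apply le_epsilon; intros eps heps.
(* The errors add up to [10 * eta]: one [eta] at [z], one at 0, and 8 from the derivative. The bound
   by 1 makes [M + 1] dominate every approximant, so that the quadratic constant is independent of
   [eps]. *)
set (eta := Rmin 1 (eps / 10)).
assert (l1 := Rmin_l 1 (eps / 10)); assert (l2 := Rmin_r 1 (eps / 10)); fold eta in l1, l2.
assert (heta : 0 < eta) by (apply Rmin_glb_lt; lra).
destruct (holomorphic_approximation f hf hs hs' eta heta) as (D & hD & hDf).
assert (hDM : forall x, Cmod x <= 1 / 2 -> Cmod (D 1%nat x) <= M + 1).
{ intros x hx; replace (D 1%nat x) with (f x + (D 1%nat x - f x))%C by ring.
  eapply Rle_trans; [apply Cmod_triangle|].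
  generalize (hfM x ltac:(lra)), (hDf x hx); lra. }
assert (hA : forall c, Cmod c = 1 -> Rabs (Re (c * D 2%nat (RtoC 0))%C - A c) <= 4 * eta).
{ intros c hc.
  assert (cD : contC (fun z => c * D 1%nat z)%C) by apply (is_wirtinger_scal_holomorphic c _ _ (hD 1%nat)).
  assert (cf : contC (fun z => c * f z)%C) by (apply contC_mult; auto; apply contC_const).
  assert (k : avg (fun t => Re ((c * D 1%nat (RtoC 0 + RtoC (1 / 4) * cis t)) * Cconj (cis t))%C) =
    1 / 4 * Re (c * D 2%nat (RtoC 0))%C).
  { apply (cauchy_formula (fun z => c * D 1%nat z)%C (fun z => c * D 2%nat z)%C
      (fun z => c * D 3%nat z)%C); [| |lra]; apply is_wirtinger_scal_holomorphic, hD. }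
  replace (Re (c * D 2%nat (RtoC 0))%C) with (4 * (1 / 4 * Re (c * D 2%nat (RtoC 0))%C)) by field.
  rewrite <- k; unfold A; rewrite <- Rmult_minus_distr_l, Rabs_mult, (Rabs_pos_eq 4) by lra.
  apply Rmult_le_compat_l; [lra|].
  assert (c1 := avg_circle_Re_conj_cis _ (RtoC 0) (1 / 4) cD).
  assert (c2 := avg_circle_Re_conj_cis _ (RtoC 0) (1 / 4) cf).
  cbv beta in c1, c2; rewrite <- avg_minus by assumption.
  apply avg_abs.
  - intros t; apply (continuous_minus (V := R_NormedModule)); auto.
  - intros t; set (x := (RtoC 0 + RtoC (1 / 4) * cis t)%C).
    assert (hx : Cmod x <= 1 / 2).
    { generalize (Cmod_circle_le (RtoC 0) (1 / 4) t); rewrite Cmod_0; fold x; lra. }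
    replace (_ - _) with (Re ((c * (D 1%nat x - f x)) * Cconj (cis t))%C).
    2:{ replace ((c * (D 1%nat x - f x)) * Cconj (cis t))%C with
          (c * D 1%nat x * Cconj (cis t) + - (c * f x * Cconj (cis t)))%C by ring.
        reflexivity. }
    eapply Rle_trans; [apply Rabs_Re_conj_cis_le|].
    rewrite Cmod_mult, hc, Rmult_1_l; auto. }
set (k := (A (RtoC 1), A (- Ci)%C)).
assert (hk : Cmod (D 2%nat (RtoC 0) - k)%C <= 8 * eta).
{ eapply Rle_trans; [apply Cmod_le_abs|].
  generalize (hA (RtoC 1) Cmod_1), (hA (- Ci)%C Cmod_opp_Ci).
  rewrite Re_Copp_Ci, Cmult_1_l.
  change (Re (D 2%nat (RtoC 0) - k)%C) with (Re (D 2%nat (RtoC 0)) - A (RtoC 1)).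
  change (Im (D 2%nat (RtoC 0) - k)%C) with (Im (D 2%nat (RtoC 0)) - A (- Ci)%C).
  lra. }
assert (ht := holomorphic_taylor D (M + 1) z hD hDM hz).
assert (h0 := hDf (RtoC 0) ltac:(rewrite Cmod_0; lra)).
assert (h1 := hDf z ltac:(lra)).
replace (f z - f (RtoC 0) - k * z)%C with
  ((D 1%nat z - D 1%nat (RtoC 0) - D 2%nat (RtoC 0) * z) +
   (- (D 1%nat z - f z) + ((D 1%nat (RtoC 0) - f (RtoC 0)) + (D 2%nat (RtoC 0) - k) * z)))%C by ring.
eapply Rle_trans; [apply Cmod_triangle|]; apply Rplus_le_compat; auto.
eapply Rle_trans; [apply Cmod_triangle|]; rewrite Cmod_opp.
assert (h2 := Cmod_triangle (D 1%nat (RtoC 0) - f (RtoC 0)) ((D 2%nat (RtoC 0) - k) * z)).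
rewrite Cmod_mult in h2.
assert (h3 : Cmod (D 2%nat (RtoC 0) - k)%C * Cmod z <= (8 * eta) * 1).
{ apply Rmult_le_compat; try apply Cmod_ge_0; lra. }
lra.
Qed.
(** * Reduction to the unit disc *)

Lemma locally_Cmod_lt (z a : C) (e : R) : Cmod (z - a)%C < e ->
  locally (T := C_UniformSpace) z (fun w => Cmod (w - a)%C < e).
Proof.
intros h.
assert (hc : cont (fun w => Cmod (w - a)%C)).
{ apply (cont_compC Cmod (fun w => w + - a)%C cont_Cmod).
  apply contC_plus; [apply contC_id|apply contC_const]. }
exact (hc z _ (open_lt e (Cmod (z - a)%C) h)).
Qed.

(** A disc inside [D] contains no boundary point, so [e] is a lower bound of the distances; a domain
    without boundary is covered too. This gives access to the filter of the hypothesis. *)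
Lemma rho_gt (D : C -> Prop) (a : C) (e r : R) :
  (forall w, Cmod (w - a)%C < e -> D w) -> r < e -> Rbar_lt (Finite r) (rho D a).
Proof.
intros hD hr.
apply Rbar_lt_le_trans with (Finite e); [exact hr|].
apply (proj2 (Glb_Rbar_correct _)).
intros d (z & hz & ->); simpl; apply Rnot_lt_le; intros hlt.
destruct (hz (fun w => Cmod (w - a)%C < e)) as (_ & w & hw & hn); [|now apply hn, hD].
now apply locally_Cmod_lt.
Qed.

Lemma open_Cmod (D : C -> Prop) (z : C) : open D -> D z ->
  exists e, 0 < e /\ forall w, Cmod (w - z)%C < e -> D w.
Proof.
intros ho hz; destruct (ho z hz) as [[e he] h]; exists e; split; auto.
intros w hw; apply h; split.
- change (Rabs (Re (w - z)%C) < e); generalize (Rabs_Re_le (w - z)%C); lra.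
- change (Rabs (Im (w - z)%C) < e); generalize (Rabs_Im_le (w - z)%C); lra.
Qed.

(** As [p] maps the whole plane into [D], restricting the neighbourhoods to [D] costs nothing. *)
Lemma contC_continuous_on (D : C -> Prop) (f p : C -> C) :
  continuous_on D f -> contC p -> (forall z, D (p z)) -> contC (fun z => f (p z)).
Proof.
intros hf [h1 h2] hD.
assert (h : forall z, filterlim (fun z => f (p z)) (locally z) (locally (f (p z)))).
{ intros z; apply (filterlim_comp _ _ _ p f _ (within D (locally (p z)))); [|now apply hf].
  intros P hP.
  assert (hp : filterlim p (locally z) (locally (p z))).
  { apply filterlim_locally; intros eps.
    generalize (filter_and _ _ (proj1 (filterlim_locally _ _) (h1 z) eps)
      (proj1 (filterlim_locally _ _) (h2 z) eps)).
    apply filter_imp; intros w [k1 k2]; now split. }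
  generalize (hp _ hP); unfold filtermap; apply filter_imp; auto. }
split; intros z.
- apply (filterlim_comp _ _ _ (fun z => f (p z)) Re _ _ _ (h z)), cont_Re.
- apply (filterlim_comp _ _ _ (fun z => f (p z)) Im _ _ _ (h z)), cont_Im.
Qed.

(** The integral is [2 * PI * rho * Ci] times the complex mean of [F * cis]; the factor [Ci]
    exchanges the components, and the imaginary part of the mean is written as a real part with
    [- Ci], as in [small_means]. *)
Lemma circle_integral_eq (f F : C -> C) (b a : C) (rho r : R) : contC F ->
  (forall t, f (b + rho * cis t)%C = F (a + r * cis t)%C) ->
  circle_integral f b rho =
    (- rho * (2 * PI * avg (fun t => Re (- Ci * F (a + r * cis t) * cis t)%C)),
     rho * (2 * PI * avg (fun t => Re (F (a + r * cis t) * cis t)%C))).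
Proof.
intros hF e; unfold circle_integral.
assert (hF' : contC (fun z => - Ci * F z)%C) by (apply contC_mult; auto; apply contC_const).
assert (c1 := avg_circle_Re_cis _ a r hF'); assert (c2 := avg_circle_Re_cis _ a r hF).
cbv beta in c1.
assert (hp : forall phi, 2 * PI * avg phi = RInt phi 0 (2 * PI)).
{ intros phi; unfold avg; field; apply PI_neq0. }
rewrite !hp; apply (is_RInt_unique (V := C_R_CompleteNormedModule)).
apply (is_RInt_fct_extend_pair (U := R_NormedModule) (V := R_NormedModule)).
- apply (is_RInt_ext (fun t => scal (- rho) (Re (- Ci * F (a + r * cis t) * cis t)%C))).
  { intros t _; rewrite e; destruct (F (a + r * cis t)%C); unfold scal, cis, Re; simpl.
    unfold mult; simpl; ring. }
  apply (is_RInt_scal (V := R_NormedModule)), (RInt_correct (V := R_CompleteNormedModule)).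
  now apply continuous1_ex.
- apply (is_RInt_ext (fun t => scal rho (Re (F (a + r * cis t) * cis t)%C))).
  { intros t _; rewrite e; destruct (F (a + r * cis t)%C); unfold scal, cis, Re; simpl.
    unfold mult; simpl; ring. }
  apply (is_RInt_scal (V := R_NormedModule)), (RInt_correct (V := R_CompleteNormedModule)).
  now apply continuous1_ex.
Qed.

Lemma is_derive_quadratic (f : C -> C) (z k : C) (B d : R) : 0 < B -> 0 < d ->
  (forall w, Cmod (w - z)%C <= d -> Cmod (f w - f z - k * (w - z))%C <=
     B * (Cmod (w - z)%C * Cmod (w - z)%C)) ->
  is_derive (K := C_AbsRing) (V := C_NormedModule) f z k.
Proof.
intros hB hd h; split; [apply is_linear_scal_l|].
intros x hx; rewrite <- (is_filter_lim_locally_unique _ _ hx); clear x hx.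
intros eps.
assert (he : 0 < Rmin d (eps / B)).
{ apply Rmin_glb_lt; auto; apply Rdiv_lt_0_compat; auto; apply eps. }
exists (mkposreal _ he); intros w hw.
change (Cmod (w - z)%C < Rmin d (eps / B)) in hw.
change (Cmod (f w - f z - (w - z) * k)%C <= eps * Cmod (w - z)%C).
assert (l1 := Rmin_l d (eps / B)); assert (l2 := Rmin_r d (eps / B)).
rewrite (Cmult_comm _ k); eapply Rle_trans; [apply h; lra|].
rewrite <- Rmult_assoc; apply Rmult_le_compat_r; [apply Cmod_ge_0|].
assert (e : B * (eps / B) = eps) by (field; now apply Rgt_not_eq).
rewrite <- e at 1; apply Rmult_le_compat_l; lra.
Qed.

Theorem theorem1p1 (D : C -> Prop) (f : C -> C)
    (hD : is_domain D)
    (hf : continuous_on D f)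
    (hJ : forall a : C, D a ->
       filterlim (fun r : R => (circle_integral f a r / RtoC (r ^ 2))%C)
         (within (fun r : R => Rbar_lt (Finite r) (rho D a)) (at_right 0))
         (locally (RtoC 0))) :
  holomorphic_on D f.
Proof.
intros z0 hz0; destruct hD as [ho _].
destruct (open_Cmod D z0 ho hz0) as (e & he & hball).
set (R0 := e / 2).
assert (hR : 0 < R0) by (unfold R0; lra).
(* Rescaling to the unit disc; the retraction keeps all values in [D], so that [f] composed with [p]
   is continuous on the plane. *)
set (p := fun z => (z0 + R0 * disc_proj z)%C).
assert (hp : contC p).
{ apply contC_plus; [apply contC_const|].
  apply contC_mult; [apply contC_const|apply contC_disc_proj]. }
assert (hin : forall z, Cmod z <= 1 -> D (z0 + R0 * z)%C).
{ intros z hz; apply hball.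
  replace (z0 + R0 * z - z0)%C with (R0 * z)%C by ring.
  rewrite Cmod_mult, Cmod_R, Rabs_pos_eq by lra; unfold R0; nra. }
assert (hpD : forall z, D (p z)) by (intros z; apply hin, disc_proj_le).
set (F := fun z => f (p z)).
assert (hF : contC F) by now apply (contC_continuous_on D f p).
assert (hFe : forall z, Cmod z <= 1 -> F z = f (z0 + R0 * z)%C).
{ intros z hz; unfold F, p; now rewrite disc_proj_id. }
assert (hJ' : forall a, Cmod a < 1 -> forall eps, 0 < eps -> exists r0, 0 < r0 /\
  forall r, 0 < r < r0 ->
    Rabs (avg (fun t => Re (F (a + r * cis t) * cis t)%C)) <= eps * r /\
    Rabs (avg (fun t => Re (- Ci * F (a + r * cis t) * cis t)%C)) <= eps * r).
{ intros a ha eps heps.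
  set (b := (z0 + R0 * a)%C).
  assert (hb : D b) by (apply hin; lra).
  (* With [eps / R0] the bound at radius [R0 * r] is [eps * r * (R0 * r)]; the last factor cancels
     against the one carried by the circle integral, and [2 * PI >= 1] is dropped. *)
  assert (hlim := hJ b hb (fun w => Cmod (w - RtoC 0)%C < eps / R0)).
  destruct hlim as [[d hd] hlim].
  { apply locally_Cmod_lt; unfold Cminus; rewrite Cplus_opp_r, Cmod_0.
    now apply Rdiv_lt_0_compat. }
  destruct (open_Cmod D b ho hb) as (e1 & he1 & hball1).
  exists (Rmin (1 - Cmod a) (Rmin d e1 / R0)); split.
  { apply Rmin_glb_lt; [lra|apply Rdiv_lt_0_compat; auto; now apply Rmin_glb_lt]. }
  intros r [hr0 hr].
  assert (l1 := Rmin_l (1 - Cmod a) (Rmin d e1 / R0)).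
  assert (l2 := Rmin_r (1 - Cmod a) (Rmin d e1 / R0)).
  assert (l3 : R0 * r < Rmin d e1).
  { rewrite Rmult_comm; apply Rlt_div_r; auto; lra. }
  assert (l4 := Rmin_l d e1); assert (l5 := Rmin_r d e1).
  assert (hRr : 0 < R0 * r) by nra.
  assert (hq : Cmod (circle_integral f b (R0 * r) / RtoC ((R0 * r) ^ 2) - RtoC 0)%C < eps / R0).
  { apply (hlim (R0 * r)).
    - change (Rabs (R0 * r - 0) < d); rewrite Rminus_0_r, Rabs_pos_eq; lra.
    - exact hRr.
    - apply (rho_gt D b e1); auto; lra. }
  assert (hq' : Cmod (circle_integral f b (R0 * r)) <= eps * r * (R0 * r)).
  { revert hq; unfold Cminus; rewrite Copp_0, Cplus_0_r.
    assert (hs : 0 < (R0 * r) ^ 2) by nra.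
    rewrite Cmod_div, Cmod_R, Rabs_pos_eq by
      (try lra; intros k; apply RtoC_inj in k; lra).
    intros k; apply (Rlt_div_l _ (eps / R0) ((R0 * r) ^ 2)) in k; auto.
    replace (eps * r * (R0 * r)) with (eps / R0 * (R0 * r) ^ 2) by (field; now apply Rgt_not_eq).
    lra. }
  rewrite (circle_integral_eq f F b a (R0 * r) r hF) in hq'.
  2:{ intros t; rewrite hFe.
    - f_equal; unfold b; rewrite RtoC_mult; ring.
    - generalize (Cmod_circle_le a r t); lra. }
  set (A := avg (fun t => Re (F (a + r * cis t) * cis t)%C)) in *.
  set (A' := avg (fun t => Re (- Ci * F (a + r * cis t) * cis t)%C)) in *.
  assert (k : forall x, Rabs (R0 * r * (2 * PI * x)) <= eps * r * (R0 * r) -> Rabs x <= eps * r).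
  { intros x; rewrite !Rabs_mult, (Rabs_pos_eq R0), (Rabs_pos_eq r), (Rabs_pos_eq 2),
      (Rabs_pos_eq PI) by (generalize PI_RGT_0; lra).
    intros hx; apply (Rmult_le_reg_l (R0 * r)); auto.
    apply Rle_trans with (2 := Rle_trans _ _ _ hx (Req_le _ _ (Rmult_comm _ _))).
    apply Rmult_le_compat_l; [lra|].
    generalize (Rabs_pos x) PI2_1; nra. }
  split; apply k; (eapply Rle_trans; [|exact hq']).
  - exact (Rabs_Im_le (- (R0 * r) * (2 * PI * A'), R0 * r * (2 * PI * A))).
  - rewrite <- Rabs_Ropp.
    replace (- (R0 * r * (2 * PI * A'))) with (- (R0 * r) * (2 * PI * A')) by ring.
    exact (Rabs_Re_le (- (R0 * r) * (2 * PI * A'), R0 * r * (2 * PI * A))). }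
destruct (quadratic_approximation F hF) as (k & B & hB & hk).
{ intros a ha eps heps; destruct (hJ' a ha eps heps) as (r0 & h0 & h1).
  exists r0; split; auto; intros r hr; apply (h1 r hr). }
{ intros a ha eps heps; destruct (hJ' a ha eps heps) as (r0 & h0 & h1).
  exists r0; split; auto; intros r hr; apply (h1 r hr). }
exists (k / R0)%C.
assert (hR' : RtoC R0 <> RtoC 0) by (intros h; apply RtoC_inj in h; lra).
(* Undoing the scaling divides the derivative by [R0], the quadratic constant by its square, and
   multiplies the radius 1/8 by [R0]. *)
apply (is_derive_quadratic f z0 (k / R0)%C (B / (R0 * R0)) (R0 / 8)).
- apply Rdiv_lt_0_compat; nra.
- lra.
- intros w hw.
  set (z := ((w - z0) / R0)%C).
  assert (hzw : (w - z0)%C = (R0 * z)%C) by (unfold z; now field).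
  assert (hzm : Cmod (w - z0)%C = R0 * Cmod z).
  { rewrite hzw, Cmod_mult, Cmod_R, Rabs_pos_eq; lra. }
  assert (hz : Cmod z <= 1 / 8) by (rewrite hzm in hw; nra).
  generalize (hk z hz).
  rewrite (hFe z) by lra; rewrite (hFe (RtoC 0)) by (rewrite Cmod_0; lra).
  rewrite <- hzw.
  replace (z0 + (w - z0))%C with w by ring.
  replace (z0 + R0 * 0)%C with z0 by ring.
  replace (k / R0 * (w - z0))%C with (k * z)%C by (rewrite hzw; now field).
  rewrite hzm.
  replace (B / (R0 * R0) * (R0 * Cmod z * (R0 * Cmod z))) with (B * (Cmod z * Cmod z))
    by (field; lra).
  auto.
Qed.
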